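(* Let $(\mathfrak{X},\pi)$, $a$, $s$, $S$, $m$ and $v$ be as in the context, assume (A), (B), (C), and assume furthermore that \[ \sup_{\emptyset\neq\mathfrak{A}\subsetneq\mathfrak{X}}\ \inf_{x\in\mathfrak{A},\,y\notin\mathfrak{A}}\Big(|a_x-a_y|+\langle |S_x-S_y|\rangle\Big)=0, \] the supremum being over measurable subsets $\mathfrak{A}$. Then the set $\mathfrak{S}$ (see context) is a single interval. In particular, there is no point $\tau_0\in\partial\mathfrak{S}$ at which there is $c\in\mathcal{B}(\mathfrak{X},\mathbb{R})$ with $\inf_xc_x>0$ such that $v_x(\tau_0+\omega)=c_x|\omega|^{1/3}+\mathcal{O}(|\omega|^{2/3})$ as $\omega\to0$ uniformly in $x$.
   Context: Let $(\mathfrak{X},\pi)$ be a measure space where $\pi$ is a probability measure; $\mathcal{B}(\mathfrak{X},\mathbb{D})$ denotes bounded measurable $\mathbb{D}$-valued functions with sup norm $\|\cdot\|$; $\langle w\rangle=\int w_x\,\pi(\mathrm{d}x)$. Let $a\in\mathcal{B}(\mathfrak{X},\mathbb{R})$, $s\in\mathcal{B}(\mathfrak{X}^2,[0,\infty))$ symmetric, $(Sw)_x=\int s_{xy}w_y\,\pi(\mathrm{d}y)$, $S_x:=(y\mapsto s_{xy})$. The equation $-1/m(z)=z+a+Sm(z)$, $z\in\mathbb{H}$ (upper half-plane), has a unique solution $m:\mathbb{H}\to\mathcal{B}(\mathfrak{X},\mathbb{H})$, and $m_x(z)=\int\frac{v_x(\mathrm{d}\tau)}{\tau-z}$ for unique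 probability measures $v_x$ on $\mathbb{R}$. Assumptions: (A) there is a symmetric $r\in\mathcal{B}(\mathfrak{X}^2,[0,\infty))$ with $s_{xy}\ge\int r_{xu}r_{uy}\,\pi(\mathrm{d}u)$ and $\inf_x\int r_{xy}\,\pi(\mathrm{d}y)>0$. (B) There is $K\in\mathbb{N}$ with $\inf_{x,y}s^{(K)}_{xy}>0$, $s^{(K)}$ the kernel of $S^K$. (C) $\lim_{\varepsilon\downarrow0}\inf_{x}\int\frac{\pi(\mathrm{d}y)}{\varepsilon+(a_x-a_y)^2+\langle (S_x-S_y)^2\rangle}=\infty$. Under (A)–(C), each $v_x$ has a continuous Lebesgue density $v_x(\tau)$, and the set $\{\tau\in\mathbb{R}:v_x(\tau)>0\}$ does not depend on $x$; it is denoted $\mathfrak{S}$. *)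

(* Defs.v *)
From HB Require Import structures.
From mathcomp Require Import all_boot all_order all_algebra.
From mathcomp Require Import all_classical all_reals all_analysis.
From mathcomp Require Import complex.
Set Implicit Arguments. Unset Strict Implicit. Unset Printing Implicit Defensive.
Import Order.TTheory GRing.Theory Num.Theory.
Import numFieldNormedType.Exports.
Local Open Scope classical_set_scope.
Local Open Scope ring_scope.

Section DysonDefs.
Context {d : measure_display} {X : measurableType d} {R : realType}.
Variable (P : probability X R).

Definition avg (w : X -> R) : R := Rintegral P setT w.

Definition cavg (w : X -> R[i]) : R[i] :=
  Complex (avg (fun y => complex.Re (w y))) (avg (fun y => complex.Im (w y))).

Definition Sop (s : X -> X -> R) (w : X -> R[i]) (x : X) : R[i] :=
  cavg (fun y => (s x y)%:C * w y)%C.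

(* s^(n.+1) : the kernel of S^(n.+1) ; skern s 0 = s *)
Fixpoint skern (s : X -> X -> R) (n : nat) : X -> X -> R :=
  match n with
  | 0 => s
  | n'.+1 => fun x y => avg (fun u => skern s n' x u * s u y)
  end.

End DysonDefs.

Definition stieltjes {R : realType} (v : R -> R) (z : R[i]) : R[i] :=
  Complex (Rintegral (@lebesgue_measure R) setT (fun t => v t * complex.Re ((t%:C - z)^-1)%C))
          (Rintegral (@lebesgue_measure R) setT (fun t => v t * complex.Im ((t%:C - z)^-1)%C)).

Definition boundary {R : realType} (A : set R) : set R :=
  closure A `\` interior A.

(* Main.v *)
(* Suppose some [v_x] vanishes at [t] although it is positive on both sides.  By
   (A) the average of [|m|^2] is bounded, by (C) so is [|m|] uniformly in
   [x, z], and by (B) the imaginary part of [m(t + i eta)] becomes uniformly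
   small in [x] for suitable small [eta], while [|m|] stays bounded below.  The
   extra assumption on [(a, S)] then forces [Re m(t + i eta)] to have one sign
   [sigma] for all [x].  Hence [w = sigma Re m(t + i eta)] is positive and, up to
   a small error, [1/w + S w = - sigma (t + a)], so that for [t'] with
   [sigma (t - t')] positive it is a strict supersolution of
   [1/|m| = |z + a + S m|] on the whole line [Re z = t'].  Decreasing [Im z] from
   infinity shows [|m| <= w <= |m(t + i eta)|] on that line, and comparing the
   imaginary parts of the equations at [t' + i eta'] and [t + i eta] by means of
   the symmetry of [S] yields [Im m(t' + i eta') = O(eta')].  So [v_x] vanishes
   on one whole side of [t], a contradiction.  A cubic-root cusp would be an
   isolated zero of [v_x] inside the interval. *)

Require Import Defs.
From HB Require Import structures.
From mathcomp Require Import all_boot all_order all_algebra.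
From mathcomp Require Import all_classical all_reals all_analysis.
From mathcomp Require Import complex measurable_realfun ring lra.
Import Order.TTheory GRing.Theory Num.Theory.
Import numFieldNormedType.Exports.
Local Open Scope classical_set_scope.
Local Open Scope ring_scope.
Set Implicit Arguments.
Unset Strict Implicit.

(** * Averages of bounded measurable functions *)

Definition bmeas {d : measure_display} {T : measurableType d} {R : realType}
    (f : T -> R) :=
  measurable_fun setT f /\ exists C, forall x, `|f x| <= C.

Lemma bounded_fun_exists (T : Type) (R : realType) (f : T -> R) :
  bounded_fun f -> exists C, forall x, `|f x| <= C.
Proof.
move=> [M [_ HM]]; exists (M + 1) => x.
by apply: (HM (M + 1)) => //; rewrite ltrDl ltr01.
Qed.

Section bounded_measurable.
Context {d : measure_display} {T : measurableType d} {R : realType}.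
Implicit Types f g : T -> R.

Lemma bmeas_ge0_bound f : bmeas f -> exists2 C, 0 <= C & forall x, `|f x| <= C.
Proof.
move=> [_ [C fC]]; exists `|C| => // x; exact: le_trans (fC x) (ler_norm C).
Qed.

Lemma bmeas_cst (c : R) : bmeas (fun _ : T => c).
Proof. by split; [exact: measurable_cst|exists `|c|]. Qed.

Lemma bmeasD f g : bmeas f -> bmeas g -> bmeas (fun x => f x + g x).
Proof.
move=> [mf [C fC]] [mg [D gD]]; split; first exact: measurable_funD.
by exists (C + D) => x; apply: le_trans (ler_normD _ _) _; exact: lerD.
Qed.

Lemma bmeasM f g : bmeas f -> bmeas g -> bmeas (fun x => f x * g x).
Proof.
move=> [mf [C fC]] [mg [D gD]]; split; first exact: measurable_funM.
by exists (C * D) => x; rewrite normrM; exact: ler_pM.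
Qed.

Lemma bmeasN f : bmeas f -> bmeas (fun x => - f x).
Proof.
move=> [mf [C fC]]; split; first exact: measurableT_comp.
by exists C => x; rewrite normrN.
Qed.

Lemma bmeasB f g : bmeas f -> bmeas g -> bmeas (fun x => f x - g x).
Proof. by move=> bf bg; apply: bmeasD => //; exact: bmeasN. Qed.

Lemma bmeasX f n : bmeas f -> bmeas (fun x => f x ^+ n).
Proof.
move=> bf; elim: n => [|n IH].
  by under eq_fun do rewrite expr0; exact: bmeas_cst.
by under eq_fun do rewrite exprS; exact: bmeasM.
Qed.

Lemma bmeas_norm f : bmeas f -> bmeas (fun x => `|f x|).
Proof.
move=> [mf [C fC]]; split; first exact: measurableT_comp.
by exists C => x; rewrite normr_id.
Qed.

Lemma bmeasV f (c : R) : 0 < c -> (forall x, c <= f x) ->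
  measurable_fun setT f -> bmeas (fun x => (f x)^-1).
Proof.
move=> c0 cf mf; have f0 x : 0 < f x by exact: lt_le_trans (cf x).
(* For [f > 0] the inverse is a composition of the measurable maps [ln], negation and [expR]. *)
have -> : (fun x => (f x)^-1) = (fun x => expR (- ln (f x))).
  by apply/funext => x; rewrite expRN lnK// posrE.
split.
  apply: measurableT_comp => //; apply: measurableT_comp => //.
  exact: measurableT_comp mf.
exists c^-1 => x; rewrite ger0_norm ?expR_ge0// expRN lnK ?posrE//.
by rewrite lef_pV2 ?posrE.
Qed.

Lemma bmeas_integrable (P : probability T R) f :
  bmeas f -> P.-integrable setT (EFin \o f).
Proof.
move=> [mf [C fC]]; apply: measurable_bounded_integrable => //.
  by apply: (le_lt_trans (probability_le1 P measurableT)); rewrite ltry.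
exists C; split; first exact: num_real.
by move=> M CM x _; exact: le_trans (fC x) (ltW CM).
Qed.

End bounded_measurable.

(** * Bounded measurable kernels on a product *)

Section bounded_measurable_product.
Context {d1 d2 : measure_display} {T1 : measurableType d1}
  {T2 : measurableType d2} {R : realType}.

Lemma bmeas_fst (f : T1 -> R) : bmeas f -> bmeas (fun p : T1 * T2 => f p.1).
Proof.
by move=> [mf [C fC]]; split; [exact: measurableT_comp|exists C => p].
Qed.

Lemma bmeas_snd (f : T2 -> R) : bmeas f -> bmeas (fun p : T1 * T2 => f p.2).
Proof.
by move=> [mf [C fC]]; split; [exact: measurableT_comp|exists C => p].
Qed.

Lemma bmeas_row (k : T1 -> T2 -> R) :
  bmeas (fun p : T1 * T2 => k p.1 p.2) -> forall x, bmeas (k x).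
Proof.
move=> [mk [C kC]] x; split; last by exists C => y; exact: (kC (x, y)).
exact: (measurable_fun_pair2 x mk).
Qed.

Lemma bmeas_col (k : T1 -> T2 -> R) :
  bmeas (fun p : T1 * T2 => k p.1 p.2) -> forall y, bmeas (k ^~ y).
Proof.
move=> [mk [C kC]] y; split; last by exists C => x; exact: (kC (x, y)).
exact: (measurable_fun_pair1 y mk).
Qed.

Lemma bmeas_swap (k : T1 -> T2 -> R) :
  bmeas (fun p : T1 * T2 => k p.1 p.2) ->
  bmeas (fun p : T2 * T1 => k p.2 p.1).
Proof.
move=> [mk [C kC]]; split; last by exists C => p; exact: (kC (p.2, p.1)).
apply: (measurableT_comp mk (g := fun p : T2 * T1 => (p.2, p.1))).
exact: measurable_fun_pair.
Qed.

End bounded_measurable_product.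

(** * Averages against [P]: linearity, Cauchy-Schwarz, Fubini *)

Section average.
Context {d : measure_display} {X : measurableType d} {R : realType}.
Variable P : probability X R.
Implicit Types f g : X -> R.

Lemma avg_fin f : bmeas f -> (\int[P]_x (f x)%:E)%E = (avg P f)%:E.
Proof.
move=> bf; rewrite /avg /Rintegral fineK//.
by apply: integrable_fin_num => //; exact: bmeas_integrable.
Qed.

Lemma avgD f g : bmeas f -> bmeas g ->
  avg P (fun x => f x + g x) = avg P f + avg P g.
Proof. by move=> bf bg; apply: RintegralD => //; exact: bmeas_integrable. Qed.

Lemma avgB f g : bmeas f -> bmeas g ->
  avg P (fun x => f x - g x) = avg P f - avg P g.
Proof. by move=> bf bg; apply: RintegralB => //; exact: bmeas_integrable. Qed.

Lemma avgZ c f : bmeas f -> avg P (fun x => c * f x) = c * avg P f.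
Proof. by move=> bf; apply: RintegralZl => //; exact: bmeas_integrable. Qed.

Lemma avg_cst c : avg P (fun=> c) = c.
Proof.
rewrite /avg Rintegral_cst//.
by have /= -> := probability_setT P; rewrite mulr1.
Qed.

Lemma le_avg f g : bmeas f -> bmeas g -> (forall x, f x <= g x) ->
  avg P f <= avg P g.
Proof.
by move=> bf bg fg; apply: le_Rintegral => //; exact: bmeas_integrable.
Qed.

Lemma avg_ge0 f : (forall x, 0 <= f x) -> 0 <= avg P f.
Proof. by move=> f0; exact: Rintegral_ge0. Qed.

Lemma norm_avg_le f : bmeas f -> `|avg P f| <= avg P (fun x => `|f x|).
Proof.
by move=> bf; apply: le_normr_Rintegral => //; exact: bmeas_integrable.
Qed.

Lemma avg_le_bound f c : bmeas f -> (forall x, f x <= c) -> avg P f <= c.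
Proof.
move=> bf fc; rewrite -[leRHS]avg_cst; apply: le_avg => //; exact: bmeas_cst.
Qed.

(* [C^2 A - 2 C B^2 + B^2 C = C (C A - B^2)], the average of [(C f - B g)^2] *)
Lemma avg_cauchy_schwarz f g c : bmeas f -> bmeas g -> 0 < c ->
  avg P (fun x => g x ^+ 2) <= c ->
  avg P (fun x => f x * g x) ^+ 2 <= c * avg P (fun x => f x ^+ 2).
Proof.
move=> bf bg c0 gc; set B := avg P (fun x => f x * g x).
set A := avg P (fun x => f x ^+ 2).
have : 0 <= avg P (fun x => (c * f x - B * g x) ^+ 2).
  by apply: avg_ge0 => x; exact: sqr_ge0.
have -> : (fun x => (c * f x - B * g x) ^+ 2) =
    (fun x => (c ^+ 2 * f x ^+ 2 - (2 * c * B) * (f x * g x))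
              + B ^+ 2 * g x ^+ 2).
  by apply/funext => x; ring.
have bf2 := bmeasX 2 bf; have bg2 := bmeasX 2 bg; have bfg := bmeasM bf bg.
have bz h (k : R) : bmeas h -> bmeas (fun x => k * h x).
  by move=> bh; apply: bmeasM => //; exact: bmeas_cst.
rewrite avgD; [|by apply: bmeasB; exact: bz|exact: bz].
rewrite avgB ?avgZ//; [|exact: bz..].
rewrite -/A -/B => H.
have : B ^+ 2 * avg P (fun x => g x ^+ 2) <= B ^+ 2 * c.
  by apply: ler_wpM2l => //; exact: sqr_ge0.
move=> H2; rewrite -subr_ge0 -(pmulr_rge0 _ c0).
apply: (le_trans H); lra.
Qed.

Lemma bmeas_avg (k : X -> X -> R) :
  bmeas (fun p : X * X => k p.1 p.2) -> bmeas (fun x => avg P (k x)).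
Proof.
move=> bk; have [C C0 kC] := bmeas_ge0_bound bk.
split; last first.
  exists C => x; apply: le_trans (norm_avg_le (bmeas_row bk x)) _.
  apply: avg_le_bound; last by move=> y; exact: (kC (x, y)).
  exact/bmeas_norm/bmeas_row.
have ik : (P \x P)%E.-integrable setT (EFin \o (fun p : X * X => k p.1 p.2)).
  exact: (bmeas_integrable (P \x P)%E).
have := measurable_fubini_F ik; rewrite /fubini_F => mF.
apply/measurable_EFinP; apply: eq_measurable_fun mF => x _ /=.
by rewrite avg_fin//; exact: bmeas_row.
Qed.

Lemma avg_swap (k : X -> X -> R) : bmeas (fun p : X * X => k p.1 p.2) ->
  avg P (fun x => avg P (k x)) = avg P (fun y => avg P (k ^~ y)).
Proof.
move=> bk.
have ik : (P \x P)%E.-integrable setT (EFin \o (fun p : X * X => k p.1 p.2)).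
  exact: (bmeas_integrable (P \x P)%E).
have := Fubini ik => /= H.
apply: EFin_inj; rewrite -!avg_fin; last 2 first.
- exact: (bmeas_avg (k := fun y x => k x y) (bmeas_swap bk)).
- exact: bmeas_avg.
under eq_integral do rewrite -(avg_fin (bmeas_row bk _)).
under [RHS]eq_integral do rewrite -(avg_fin (bmeas_col bk _)).
exact: H.
Qed.

End average.

(** * The Dyson equation *)

Section kernel_operator.
Context {d : measure_display} {X : measurableType d} {R : realType}.
Variable P : probability X R.

(** Real form of [Sop]: the kernel is real, so S acts separately on real and imaginary parts. *)
Definition kop (s : X -> X -> R) (f : X -> R) (x : X) : R :=
  avg P (fun y => s x y * f y).

Variable s : X -> X -> R.
Hypothesis bs : bmeas (fun p : X * X => s p.1 p.2).

Lemma bmeas_kop_ker f x : bmeas f -> bmeas (fun y => s x y * f y).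
Proof. by move=> bf; apply: bmeasM => //; exact: bmeas_row. Qed.

Lemma bmeas_kop f : bmeas f -> bmeas (kop s f).
Proof.
move=> bf; apply: (bmeas_avg P (k := fun x y => s x y * f y)).
by apply: bmeasM => //; exact: bmeas_snd.
Qed.

Lemma kopZ c f x : bmeas f -> kop s (fun y => c * f y) x = c * kop s f x.
Proof.
move=> bf; rewrite /kop -avgZ; last exact: bmeas_kop_ker.
by congr avg; apply/funext => y; ring.
Qed.

Hypothesis s_ge0 : forall x y, 0 <= s x y.

Lemma kop_ge0 f x : (forall y, 0 <= f y) -> 0 <= kop s f x.
Proof. by move=> f0; apply: avg_ge0 => y; exact: mulr_ge0. Qed.

Lemma norm_kop_le f g x : bmeas f -> bmeas g -> (forall y, `|f y| <= g y) ->
  `|kop s f x| <= kop s g x.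
Proof.
move=> bf bg fg; apply: le_trans (norm_avg_le P (bmeas_kop_ker x bf)) _.
apply: le_avg; [exact/bmeas_norm/bmeas_kop_ker|exact: bmeas_kop_ker|].
by move=> y; rewrite normrM (ger0_norm (s_ge0 _ _)); exact: ler_wpM2l.
Qed.

Lemma kop_le_avg B f x : bmeas f -> (forall x y, s x y <= B) ->
  (forall y, 0 <= f y) -> kop s f x <= B * avg P f.
Proof.
move=> bf sB f0; rewrite -avgZ//; apply: le_avg; first exact: bmeas_kop_ker.
  by apply: bmeasM => //; exact: bmeas_cst.
by move=> y; exact: ler_wpM2r.
Qed.

Hypothesis s_sym : forall x y, s x y = s y x.

(** Selfadjointness of S in L^2([P]), from Fubini and the symmetry of the kernel. *)
Lemma avg_kop_sym f g : bmeas f -> bmeas g ->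
  avg P (fun x => f x * kop s g x) = avg P (fun x => g x * kop s f x).
Proof.
move=> bf bg.
have := avg_swap P (k := fun x y => f x * (s x y * g y)).
have -> : (fun x => avg P (fun y => f x * (s x y * g y))) =
    (fun x => f x * kop s g x).
  by apply/funext => x; rewrite avgZ//; exact: bmeas_kop_ker.
have -> : (fun y => avg P (fun x => f x * (s x y * g y))) =
    (fun x => g x * kop s f x).
  apply/funext => y; rewrite /kop -avgZ; last exact: bmeas_kop_ker.
  by congr avg; apply/funext => x; rewrite s_sym; ring.
apply; apply: bmeasM; first exact: bmeas_fst.
by apply: bmeasM => //; exact: bmeas_snd.
Qed.

End kernel_operator.

(** * Upper bounds on |m|^2: on average from (A), pointwise from (C) *)

Section dyson_solution.
Context {d : measure_display} {X : measurableType d} {R : realType}.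
Variable P : probability X R.
Variables (a : X -> R) (s : X -> X -> R).

(* The Dyson equation at the spectral parameter [tau + i eta] for the solution
   [p + i h]: multiplying [-1/m = z + a + S m] by [|m|^2] separates its real
   and imaginary parts. *)
Definition dyson (tau eta : R) (p h : X -> R) :=
  [/\ bmeas p, bmeas h, (forall x, 0 < h x),
   (forall x, - p x = (p x ^+ 2 + h x ^+ 2) * (tau + a x + kop P s p x)) &
   (forall x, h x = (p x ^+ 2 + h x ^+ 2) * (eta + kop P s h x))].

Lemma dyson_abs2_gt0 tau eta p h x : dyson tau eta p h ->
  0 < p x ^+ 2 + h x ^+ 2.
Proof.
by case=> _ _ h0 _ _; apply: ltr_wpDl; rewrite ?sqr_ge0// exprn_gt0.
Qed.

Lemma bmeas_abs2 (p h : X -> R) : bmeas p -> bmeas h ->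
  bmeas (fun x => p x ^+ 2 + h x ^+ 2).
Proof. by move=> bp bh; apply: bmeasD; exact: bmeasX. Qed.

(** This is the squared modulus of -1/m = z + a + S m. *)
Lemma dyson_inv_abs2 tau eta p h x : dyson tau eta p h ->
  (p x ^+ 2 + h x ^+ 2)^-1 =
    (tau + a x + kop P s p x) ^+ 2 + (eta + kop P s h x) ^+ 2.
Proof.
move=> D; have n0 := dyson_abs2_gt0 x D; case: D => _ _ _ eqp eqh.
apply: (mulfI (lt0r_neq0 n0)); rewrite divff ?lt0r_neq0//.
apply: (mulfI (lt0r_neq0 n0)); rewrite mulr1.
rewrite {1}(_ : p x ^+ 2 = (- p x) ^+ 2); last by ring.
by rewrite {1}eqp {1}[in X in _ + X]eqh; ring.
Qed.

Hypothesis bs : bmeas (fun p : X * X => s p.1 p.2).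
Hypothesis s_ge0 : forall x y, 0 <= s x y.
Hypothesis s_sym : forall x y, s x y = s y x.

(* Schur test for [|m| S |m|] with the weight [h / |m|], a supersolution by the
   imaginary part of the equation; [n = |m|^2 = h phi]. *)
Lemma dyson_schur tau eta p h : 0 < eta -> dyson tau eta p h ->
  avg P (fun x => (p x ^+ 2 + h x ^+ 2) *
                  kop P s (fun y => p y ^+ 2 + h y ^+ 2) x) <=
  avg P (fun x => p x ^+ 2 + h x ^+ 2).
Proof.
move=> eta0 [bp bh h0 _ eqh]; pose n x := p x ^+ 2 + h x ^+ 2.
rewrite -/n -[leLHS]/(avg P (fun x => n x * kop P s n x)).
pose phi x := (eta + kop P s h x)^-1.
have Sh0 x : 0 <= kop P s h x by apply: kop_ge0 => // y; exact: ltW.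
have bSh : bmeas (kop P s h) by exact: bmeas_kop.
have bphi : bmeas phi.
  apply: (bmeasV (c := eta)) => //; first by move=> x; rewrite lerDl.
  by apply: measurable_funD => //; case: bSh.
have phi0 x : 0 < phi x by rewrite invr_gt0 ltr_pwDl.
have nE : n = fun x => h x * phi x.
  by apply/funext => x; rewrite {1}eqh mulfK// gt_eqF// ltr_pwDl.
pose g x := h x * phi x ^+ 2.
have bg : bmeas g by apply: bmeasM => //; exact: bmeasX.
have bn : bmeas n by exact: bmeas_abs2.
have g0 x : 0 <= g x by rewrite mulr_ge0 ?sqr_ge0// ltW.
(* AM-GM: [n x * n y = h x * h y * phi x * phi y] is at most half of
   [h x * h y * (phi x ^+ 2 + phi y ^+ 2)], which [g = h phi^2] expresses through S. The defect is a
   multiple of [(phi x - phi y) ^+ 2]. *)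
have step1 x : n x * kop P s n x <=
    2^-1 * (g x * kop P s h x + h x * kop P s g x).
  have br f1 f2 : bmeas f2 -> bmeas (fun u => f1 x * (s x u * f2 u)).
    by move=> bf2; apply: bmeasM; [exact: bmeas_cst|exact: bmeas_kop_ker].
  have -> : 2^-1 * (g x * kop P s h x + h x * kop P s g x) =
      avg P (fun u => 2^-1 * (g x * (s x u * h u) + h x * (s x u * g u))).
    rewrite avgZ; last by apply: bmeasD; exact: br.
    rewrite avgD; [|exact: br..].
    by rewrite !avgZ//; exact: bmeas_kop_ker.
  rewrite -avgZ; last exact: bmeas_kop_ker.
  apply: le_avg; first exact: br.
    by apply: bmeasM; [exact: bmeas_cst|apply: bmeasD; exact: br].
  move=> y; rewrite nE /g -subr_ge0.
  rewrite (_ : _ - _ = 2^-1 * (s x y * (h x * h y)) * (phi x - phi y) ^+ 2).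
    apply: mulr_ge0; last exact: sqr_ge0.
    by rewrite mulr_ge0 ?invr_ge0// mulr_ge0// mulr_ge0// ltW.
  by field.
have bk f : bmeas f -> bmeas (kop P s f) by exact: bmeas_kop.
have bM f1 f2 : bmeas f1 -> bmeas f2 -> bmeas (fun x => f1 x * kop P s f2 x).
  by move=> b1 b2; apply: bmeasM => //; exact: bk.
apply: (@le_trans _ _ (avg P (fun x =>
    2^-1 * (g x * kop P s h x + h x * kop P s g x)))).
  apply: le_avg => //; first exact: bM.
  by apply: bmeasM; [exact: bmeas_cst|apply: bmeasD; exact: bM].
rewrite avgZ; last by apply: bmeasD; exact: bM.
rewrite avgD; [|exact: bM..].
(* By symmetry both halves have the same average, and [phi * S h <= 1] bounds
   [g * S h = h phi^2 S h] by [h phi = n]. *)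
rewrite (avg_kop_sym P bs s_sym bh bg).
rewrite (_ : 2^-1 * (_ + _) = avg P (fun x => g x * kop P s h x)); last by field.
apply: le_avg => //; first exact: bM.
move=> x; rewrite nE /g expr2 -!mulrA ler_pM2l// -[leRHS]mulr1.
by rewrite ler_pM2l// mulrC ler_pdivrMr ?mul1r ?lerDr ?ltW// ltr_pwDl.
Qed.

(** With n = |m|^2 and R the operator of [r], the Schur bound and (A) give <n> >= <n S n> >= <(R
    n)^2> >= <R n>^2 >= delta^2 <n>^2. *)
Lemma dyson_avg_abs2_le (r : X -> X -> R) (delta : R) :
  bmeas (fun p : X * X => r p.1 p.2) -> (forall x y, 0 <= r x y) ->
  (forall x y, r x y = r y x) ->
  (forall x y, avg P (fun u => r x u * r u y) <= s x y) ->
  0 < delta -> (forall x, delta <= avg P (r x)) ->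
  forall tau eta p h, 0 < eta -> dyson tau eta p h ->
  avg P (fun x => p x ^+ 2 + h x ^+ 2) <= (delta ^+ 2)^-1.
Proof.
move=> br r0 r_sym rs delta0 rdelta tau eta p h eta0 D.
have := dyson_schur eta0 D.
pose n x := p x ^+ 2 + h x ^+ 2.
rewrite -/n -[X in X <= _ -> _]/(avg P (fun x => n x * kop P s n x)) => schur.
have n_gt0 x : 0 < n x by exact: dyson_abs2_gt0 D.
have bn : bmeas n by case: D => bp bh *; exact: bmeas_abs2.
have bRn : bmeas (kop P r n) by exact: bmeas_kop.
have n0 : 0 <= avg P n by apply: avg_ge0 => x; exact: ltW.
have H1 : delta * avg P n <= avg P (kop P r n).
  have -> : avg P (kop P r n) = avg P (fun x => n x * kop P r (fun=> 1) x).
    rewrite avg_kop_sym//; last exact: bmeas_cst.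
    by congr avg; apply/funext => x; rewrite mul1r.
  rewrite -avgZ//; apply: le_avg.
  - by apply: bmeasM => //; exact: bmeas_cst.
  - by apply: bmeasM => //; apply: bmeas_kop => //; exact: bmeas_cst.
  move=> x; rewrite mulrC ler_pM2l// /kop.
  by under eq_fun do rewrite mulr1.
have H2 : avg P (kop P r n) ^+ 2 <= avg P (fun x => kop P r n x ^+ 2).
  have := @avg_cauchy_schwarz _ _ _ P (kop P r n) (fun=> 1) 1 bRn
    (bmeas_cst 1) ltr01.
  under eq_fun do rewrite expr1n.
  rewrite avg_cst mul1r => /(_ (lexx _)).
  by under eq_fun do rewrite mulr1.
have H3 : avg P (fun x => kop P r n x ^+ 2) <= avg P (fun x => n x * kop P s n x).
  under eq_fun do rewrite expr2.
  rewrite avg_kop_sym//; apply: le_avg.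
  - by apply: bmeasM => //; exact: bmeas_kop.
  - by apply: bmeasM => //; exact: bmeas_kop.
  move=> x; rewrite ler_pM2l//.
  have bk3 : bmeas (fun q : X * X => r x q.1 * (r q.1 q.2 * n q.2)).
    apply: (bmeasM (f := fun q : X * X => r x q.1)).
      by apply: bmeas_fst; exact: (bmeas_row br).
    by apply: bmeasM => //; exact: bmeas_snd.
  have -> : kop P r (kop P r n) x =
      avg P (fun u => avg P (fun y => r x u * (r u y * n y))).
    congr avg; apply/funext => u; rewrite avgZ//; exact: bmeas_kop_ker.
  rewrite (avg_swap P (k := fun u y => r x u * (r u y * n y)))//.
  apply: le_avg; last first.
  - move=> y; rewrite [leRHS]mulrC.
    have -> : (fun u => r x u * (r u y * n y)) =
        (fun u => n y * (r x u * r u y)) by apply/funext => u; ring.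
    rewrite avgZ; first by rewrite ler_pM2l.
    apply: bmeasM; first exact: (bmeas_row br).
    exact: (bmeas_col br).
  - exact: bmeas_kop_ker.
  - exact: (bmeas_avg P (k := fun y u => r x u * (r u y * n y)) 
      (bmeas_swap (k := fun u y => r x u * (r u y * n y)) bk3)).
(* The chain is quadratic in <n>; cancelling one factor needs <n> nonzero. *)
have [->|nN0] := eqVneq (avg P n) 0; first by rewrite invr_ge0 sqr_ge0.
have n_pos : 0 < avg P n by rewrite lt_neqAle eq_sym nN0.
have d2 : 0 < delta ^+ 2 by rewrite exprn_gt0.
rewrite -(ler_pM2l d2) divff ?gt_eqF// -(ler_pM2r n_pos) mul1r -mulrA -expr2.
rewrite -exprMn; apply: le_trans schur; apply: le_trans H3.
apply: le_trans H2; rewrite lerXn2r// ?nnegrE//.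
  by rewrite mulr_ge0// ltW.
by apply: le_trans H1; rewrite mulr_ge0// ltW.
Qed.

(** If |m|^2 were above 1/eps at x, then z + a + S m would be small at x. Passing to y changes it by
    a_x - a_y and (S_x - S_y) m, the latter controlled by Cauchy-Schwarz and the averaged bound [N].
    Thus |m_y|^2 dominates a multiple of the integrand in (C), whose integral would then stay
    bounded. *)
Lemma dyson_abs2_le (N : R) : bmeas a -> 0 < N ->
  (forall M : R, exists2 eps0 : R, 0 < eps0 & forall eps : R, 0 < eps < eps0 ->
     forall x, (M%:E <= \int[P]_y
        ((eps + (a x - a y) ^+ 2 + avg P (fun u => (s x u - s y u) ^+ 2))^-1)%:E)%E) ->
  exists2 Phi : R, 0 < Phi & forall tau eta p h, dyson tau eta p h ->
    avg P (fun x => p x ^+ 2 + h x ^+ 2) <= N ->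
    forall x, p x ^+ 2 + h x ^+ 2 <= Phi.
Proof.
move=> ba N0 hypC; pose C := 3 * (1 + N).
have C0 : 0 < C by rewrite mulr_gt0// addr_gt0.
(* The argument below bounds the integral in (C) by [2 * C * N], so this value of M is out of
   reach. *)
have [eps0 eps00 Heps] := hypC (2 * C * N + 1).
pose eps := eps0 / 2.
have epsP : 0 < eps < eps0 by rewrite /eps; apply/andP; split; lra.
have eps_gt0 : 0 < eps by case/andP: epsP.
exists eps^-1; first by rewrite invr_gt0.
move=> tau eta p h D nN x.
have n_gt0 y : 0 < p y ^+ 2 + h y ^+ 2 by exact: dyson_abs2_gt0 D.
rewrite leNgt; apply/negP => nx.
have nxV : (p x ^+ 2 + h x ^+ 2)^-1 < eps.
  by rewrite -[ltRHS]invrK ltf_pV2 ?posrE ?invr_gt0.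
have := Heps _ epsP x; apply/negP; rewrite -ltNge.
have [bp bh h0 eqp eqh] := D.
pose Q y := avg P (fun u => (s x u - s y u) ^+ 2).
have bsB y : bmeas (fun u => s x u - s y u).
  by apply: bmeasB; exact: (bmeas_row bs).
have Q0 y : 0 <= Q y by apply: avg_ge0 => u; exact: sqr_ge0.
have bQ : bmeas Q.
  apply: (bmeas_avg P (k := fun y u => (s x u - s y u) ^+ 2)).
  apply: bmeasX; apply: bmeasB => //.
  by apply: bmeas_snd; exact: (bmeas_row bs).
have avg_sqr f : bmeas f -> (forall y, f y ^+ 2 <= p y ^+ 2 + h y ^+ 2) ->
    avg P (fun y => f y ^+ 2) <= N.
  move=> bf fn; apply: le_trans nN; apply: le_avg => //; first exact: bmeasX.
  exact: bmeas_abs2.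
have kB f y : bmeas f ->
    kop P s f y = kop P s f x - avg P (fun u => (s x u - s y u) * f u).
  move=> bf; rewrite (_ : avg P (fun u => (s x u - s y u) * f u) =
    kop P s f x - kop P s f y); first by ring.
  rewrite /kop -avgB; [|exact: bmeas_kop_ker..].
  by congr avg; apply/funext => u; ring.
have sq3 (u v w : R) : (u - v - w) ^+ 2 <= 3 * (u ^+ 2 + v ^+ 2 + w ^+ 2).
  rewrite -subr_ge0 (_ : _ - _ = (u + v) ^+ 2 + (u + w) ^+ 2 + (v - w) ^+ 2).
    by rewrite !addr_ge0// sqr_ge0.
  by ring.
have CS f y : bmeas f -> avg P (fun u => f u ^+ 2) <= N ->
    avg P (fun u => (s x u - s y u) * f u) ^+ 2 <= N * Q y.
  by move=> bf fN; exact: avg_cauchy_schwarz.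
have key y : (p y ^+ 2 + h y ^+ 2)^-1 <=
    2 * C * (eps + (a x - a y) ^+ 2 + Q y).
  have := dyson_inv_abs2 x D; have -> := dyson_inv_abs2 y D => ex.
  rewrite (kB p)// (kB h)//.
  have cp : avg P (fun u => (s x u - s y u) * p u) ^+ 2 <= N * Q y.
    by apply: CS => //; apply: avg_sqr => // u; rewrite lerDl sqr_ge0.
  have ch : avg P (fun u => (s x u - s y u) * h u) ^+ 2 <= N * Q y.
    by apply: CS => //; apply: avg_sqr => // u; rewrite lerDr sqr_ge0.
  have := sq3 (tau + a x + kop P s p x) (a x - a y)
    (avg P (fun u => (s x u - s y u) * p u)).
  (* The imaginary part contains no [a], hence the 0. The factor 3 of [sq3], and [N * Q y] occurring
     once for [p] and once for [h], explain [2 * C = 6 * (1 + N)]. *)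
  have := sq3 (eta + kop P s h x) 0 (avg P (fun u => (s x u - s y u) * h u)).
  have -> : tau + a x + kop P s p x - (a x - a y) -
    avg P (fun u => (s x u - s y u) * p u) = tau + a y +
    (kop P s p x - avg P (fun u => (s x u - s y u) * p u)) by ring.
  have -> : eta + kop P s h x - 0 - avg P (fun u => (s x u - s y u) * h u) =
    eta + (kop P s h x - avg P (fun u => (s x u - s y u) * h u)) by ring.
  have aa : 0 <= (a x - a y) ^+ 2 by exact: sqr_ge0.
  have QN : 0 <= N * (a x - a y) ^+ 2 by rewrite mulr_ge0// ltW.
  have Ne : 0 <= N * eps by rewrite mulr_ge0// ltW.
  have := Q0 y; have NQ : 0 <= N * Q y by rewrite mulr_ge0// ltW.
  move: nxV; rewrite ex /C expr0n/=; lra.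
pose E y := eps + (a x - a y) ^+ 2 + Q y.
have Eeps y : eps <= E y by rewrite /E -addrA lerDl addr_ge0// sqr_ge0.
have E_gt0 y : 0 < E y by exact: lt_le_trans (Eeps y).
have bEV : bmeas (fun y => (E y)^-1).
  apply: (bmeasV eps_gt0 Eeps).
  suff [] : bmeas E by [].
  apply: bmeasD => //; apply: bmeasD; first exact: bmeas_cst.
  by apply: bmeasX; apply: bmeasB => //; exact: bmeas_cst.
have bn2 : bmeas (fun y => 2 * C * (p y ^+ 2 + h y ^+ 2)).
  by apply: bmeasM; [exact: bmeas_cst|exact: bmeas_abs2].
rewrite -/(Q _) -/(E _) (avg_fin P bEV) lte_fin.
apply: (@le_lt_trans _ _ (avg P (fun y => 2 * C * (p y ^+ 2 + h y ^+ 2)))).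
  apply: le_avg => // y.
  by rewrite -[leLHS]mul1r ler_pdivrMr// mulrAC -ler_pdivrMr// mul1r key.
rewrite avgZ; last exact: bmeas_abs2.
by apply: (@le_lt_trans _ _ (2 * C * N)); rewrite ?ltrDl// ler_pM2l// mulr_gt0.
Qed.

End dyson_solution.

(** * Lower bound on |m|, Harnack inequality for Im m, sign of Re m, comparison of two solutions *)

Section dyson_estimates.
Context {d : measure_display} {X : measurableType d} {R : realType}.
Variable P : probability X R.
Variables (a : X -> R) (s : X -> X -> R) (B : R).
Hypothesis ba : bmeas a.
Hypothesis bs : bmeas (fun p : X * X => s p.1 p.2).
Hypothesis s_ge0 : forall x y, 0 <= s x y.
Hypothesis s_sym : forall x y, s x y = s y x.
Hypothesis B_gt0 : 0 < B.
Hypothesis s_le : forall x y, s x y <= B.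

(** Since Phi <= (1 + Phi)^2, [1 + Phi] serves as a bound free of square roots. *)
Lemma abs2_le_normp (p h Phi : R) : 0 < Phi -> p ^+ 2 + h ^+ 2 <= Phi ->
  `|p| <= 1 + Phi.
Proof.
move=> Phi0 n_le; rewrite -ler_sqr ?nnegrE//; last by rewrite addr_ge0// ltW.
rewrite real_normK ?num_real//.
have := sqr_ge0 h; have := sqr_ge0 Phi; rewrite sqrrD expr1n mul1r; lra.
Qed.

Lemma abs2_le_normh (p h Phi : R) : 0 < Phi -> p ^+ 2 + h ^+ 2 <= Phi ->
  `|h| <= 1 + Phi.
Proof. by move=> Phi0; rewrite addrC; exact: abs2_le_normp. Qed.

Lemma norm_kop_cst_le f L x : bmeas f -> (forall y, `|f y| <= L) ->
  `|kop P s f x| <= B * L.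
Proof.
move=> bf fL.
have := norm_kop_le P bs s_ge0 x bf (bmeas_cst L) fL; move/le_trans; apply.
have L0 : 0 <= L by apply: le_trans (fL x).
apply: (le_trans (kop_le_avg P bs x (bmeas_cst L) s_le (fun=> L0))).
by rewrite avg_cst.
Qed.

(** 1/|m| = |z + a + S m| is bounded because [a], S and |m| are; [eta <= 1] makes the constant
    independent of [eta]. *)
Lemma dyson_abs2_ge (tau Phi : R) : 0 < Phi ->
  exists2 c : R, 0 < c & forall eta p h, 0 < eta <= 1 ->
    dyson P a s tau eta p h -> (forall x, p x ^+ 2 + h x ^+ 2 <= Phi) ->
    forall x, c <= p x ^+ 2 + h x ^+ 2.
Proof.
move=> Phi0; have [A A0 aA] := bmeas_ge0_bound ba.
pose L := 1 + Phi.
pose D := (`|tau| + A + B * L) ^+ 2 + (1 + B * L) ^+ 2.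
have BL : 0 < B * L by rewrite mulr_gt0// addr_gt0.
have D0 : 0 < D by rewrite ltr_wpDl ?sqr_ge0// exprn_gt0// addr_gt0.
exists D^-1; first by rewrite invr_gt0.
move=> eta p h /andP[eta0 eta1] dy n_le x.
rewrite -[leRHS]invrK lef_pV2 ?posrE ?invr_gt0 ?(dyson_abs2_gt0 x dy)//.
rewrite (dyson_inv_abs2 x dy); have [bp bh _ _ _] := dy.
have kp : `|kop P s p x| <= B * L.
  by apply: norm_kop_cst_le => // y; exact: abs2_le_normp (n_le y).
have kh : `|kop P s h x| <= B * L.
  by apply: norm_kop_cst_le => // y; exact: abs2_le_normh (n_le y).
have sq (u v : R) : `|u| <= v -> u ^+ 2 <= v ^+ 2.
  move=> uv; rewrite -(real_normK (num_real u)) lerXn2r ?nnegrE//.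
  exact: le_trans uv.
apply: lerD; apply: sq.
  apply: le_trans (ler_normD _ _) _; apply: lerD => //.
  by apply: le_trans (ler_normD _ _) _; apply: lerD.
apply: le_trans (ler_normD _ _) _; apply: lerD => //.
by rewrite ger0_norm// ltW.
Qed.

Lemma bmeas_skern j x : bmeas (skern P s j x).
Proof.
elim: j => [|j IH] /=; first exact: (bmeas_row bs).
apply: (bmeas_avg P (k := fun y u => skern P s j x u * s u y)).
apply: (bmeas_swap (k := fun u y => skern P s j x u * s u y)).
apply: (bmeasM (f := fun q : X * X => skern P s j x q.1)) => //.
exact: bmeas_fst.
Qed.

Lemma skern_ge0 j x y : 0 <= skern P s j x y.
Proof.
elim: j x y => [|j IH] x y //=.
by apply: avg_ge0 => u; exact: mulr_ge0.
Qed.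

(** Dropping [eta] from the imaginary part leaves [h >= c * S h], which is iterated. [skern P s j]
    is the kernel of S^(j+1), hence the exponent. *)
Lemma dyson_skern_le (tau eta c : R) p h j x : 0 < eta -> 0 < c ->
  dyson P a s tau eta p h -> (forall x, c <= p x ^+ 2 + h x ^+ 2) ->
  c ^+ j.+1 * avg P (fun y => skern P s j x y * h y) <= h x.
Proof.
move=> eta0 c0 dy c_le; have [_ bh h0 _ eqh] := dy.
have kh x' : c * kop P s h x' <= h x'.
  rewrite [leRHS]eqh; apply: ler_pM => //; first exact: ltW.
    by apply: kop_ge0 => // y; exact: ltW.
  by rewrite lerDr ltW.
elim: j => [|j IH]; first by rewrite expr1; exact: kh.
apply: le_trans IH; rewrite exprSr -mulrA ler_pM2l ?exprn_gt0//=.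
have bsk := bmeas_skern j x.
have bk : bmeas (fun q : X * X => skern P s j x q.1 * (s q.1 q.2 * h q.2)).
  apply: (bmeasM (f := fun q : X * X => skern P s j x q.1)).
    exact: bmeas_fst.
  by apply: bmeasM => //; exact: bmeas_snd.
have -> : (fun y => avg P (fun u => skern P s j x u * s u y) * h y) =
    (fun y => avg P (fun u => skern P s j x u * (s u y * h y))).
  apply/funext => y; rewrite mulrC -avgZ.
    by congr avg; apply/funext => u; ring.
  by apply: bmeasM => //; exact: (bmeas_col bs).
rewrite -(avg_swap P bk).
have -> : (fun u => avg P (fun y => skern P s j x u * (s u y * h y))) =
    (fun u => skern P s j x u * kop P s h u).
  by apply/funext => u; rewrite avgZ//; exact: bmeas_kop_ker.
have bkk : bmeas (fun u => skern P s j x u * kop P s h u).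
  by apply: bmeasM => //; exact: bmeas_kop.
rewrite -avgZ//; apply: le_avg.
- by apply: bmeasM => //; exact: bmeas_cst.
- exact: bmeasM.
by move=> u; rewrite mulrCA; apply: ler_wpM2l => //; exact: skern_ge0.
Qed.

Lemma dyson_im_le_avg (tau eta Phi : R) p h x : 0 < eta ->
  dyson P a s tau eta p h -> (forall x, p x ^+ 2 + h x ^+ 2 <= Phi) ->
  h x <= Phi * (eta + B * avg P h).
Proof.
move=> eta0 dy n_le; have [_ bh h0 _ eqh] := dy.
rewrite eqh; apply: ler_pM => //.
- by rewrite addr_ge0 ?sqr_ge0.
- by rewrite addr_ge0 ?(ltW eta0)// kop_ge0// => y; exact: ltW.
by rewrite lerD2l kop_le_avg// => y; exact: ltW.
Qed.

(** Harnack inequality: by (B) the value [h x0] controls the average of [h], and that average,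
    together with [eta], controls [h] everywhere. *)
Lemma dyson_im_uniform (tau Phi c delta eps : R) (K : nat) :
  0 < Phi -> 0 < c -> 0 < delta -> 0 < eps ->
  (forall x y, delta <= skern P s K x y) ->
  exists2 e : R, 0 < e & forall eta p h x0, 0 < eta < e ->
    dyson P a s tau eta p h -> (forall x, p x ^+ 2 + h x ^+ 2 <= Phi) ->
    (forall x, c <= p x ^+ 2 + h x ^+ 2) -> h x0 < e ->
    forall x, h x <= eps.
Proof.
move=> Phi0 c0 delta0 eps0 sK; pose G := c ^+ K.+1 * delta.
have G0 : 0 < G by rewrite mulr_gt0// exprn_gt0.
pose Z := Phi * (1 + B / G).
have Z0 : 0 < Z by rewrite mulr_gt0// addr_gt0// divr_gt0.
(* With e = eps / Z, the final bound Phi (e + B e / G) equals e Z = eps. *)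
exists (eps / Z); first exact: divr_gt0.
move=> eta p h x0 /andP[eta0 eta_lt] dy n_le n_ge hx0 x.
have [_ bh h0 _ _] := dy.
have H1 : G * avg P h <= h x0.
  apply: le_trans (dyson_skern_le K x0 eta0 c0 dy n_ge).
  rewrite -mulrA ler_pM2l ?exprn_gt0// -avgZ//; apply: le_avg.
  - by apply: bmeasM => //; exact: bmeas_cst.
  - by apply: bmeasM => //; exact: bmeas_skern.
  by move=> y; rewrite ler_pM2r.
apply: (le_trans (dyson_im_le_avg x eta0 dy n_le)).
have : avg P h <= (eps / Z) / G.
  by rewrite ler_pdivlMr// mulrC; apply: (le_trans H1); exact: ltW.
move=> H2; apply: (@le_trans _ _ (Phi * (eps / Z + B * (eps / Z / G)))).
  by rewrite ler_pM2l//; apply: lerD; [exact: ltW|rewrite ler_pM2l].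
rewrite (_ : _ * _ = eps / Z * Z) ?divfK ?gt_eqF//.
by rewrite /Z; field; rewrite !gt_eqF// ?addr_gt0// ?mulr_gt0 ?addr_gt0.
Qed.

(** If Re m took both signs, split X into A = {Re m > 0} and its complement. By the real part of the
    equation, E = tau + a + S p is bounded away below 0 on A and nonnegative off A, whereas E y - E
    x is at most L times the distance in the extra assumption. So the infimum for A would be
    positive. *)
Lemma dyson_re_sign (tau eta Phi c : R) p h : 0 < Phi -> 0 < c ->
  ereal_sup [set ereal_inf
      [set (`|a x - a y| + avg P (fun u => `|s x u - s y u|))%:E
         | x in A & y in ~` A]
    | A in [set A : set X | [/\ measurable A, A !=set0 & A != setT]]] = 0%E ->
  dyson P a s tau eta p h -> (forall x, p x ^+ 2 + h x ^+ 2 <= Phi) ->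
  (forall x, c <= p x ^+ 2) ->
  (forall x, 0 < p x) \/ (forall x, p x < 0).
Proof.
move=> Phi0 c0 hypD dy n_le p_ge; pose A := [set x | 0 < p x].
have n_gt0 x := dyson_abs2_gt0 x dy.
have [bp bh h0 eqp _] := dy.
have [/eqP AT|AnT] := boolP (A == setT).
  by left => x; have : A x by rewrite AT.
have [A0|/set0P A0] := eqVneq A set0.
  right => x; rewrite ltNge; apply/negP; rewrite le_eqVlt => /orP[/eqP px|px].
    by have := p_ge x; rewrite -px expr0n/= leNgt c0.
  by have : A x by []; rewrite A0.
exfalso; pose L := 1 + Phi.
have L1 : 1 <= L by rewrite lerDl ltW.
have L0 : 0 < L by exact: lt_le_trans L1.
(* The gap of E is at least c / (L Phi); division by the Lipschitz constant [L] gives [theta]. *)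
pose theta := c / (L ^+ 2 * Phi).
have theta0 : 0 < theta by rewrite divr_gt0// mulr_gt0// exprn_gt0.
have mA : measurable A.
  rewrite /A (_ : [set x | _] = p @^-1` `]0, +oo[%classic); last first.
    by apply/seteqP; split => x /=; rewrite in_itv/= andbT.
  by rewrite -[X in measurable X]setTI; case: bp => mp _; exact: mp.
have : (ereal_inf [set (`|a x - a y| + avg P (fun u => `|s x u - s y u|))%:E
         | x in A & y in ~` A] < theta%:E)%E.
  apply: (@le_lt_trans _ _ 0%E); last by rewrite lte_fin.
  by rewrite -hypD; apply: ereal_sup_ubound; exists A.
move=> /ereal_inf_lt[_ [x Ax [y Ay <-]]]; rewrite lte_fin; apply/negP.
rewrite -leNgt.
have px : 0 < p x by [].
have py : p y <= 0 by rewrite leNgt; apply/negP.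
have pL z : `|p z| <= L by exact: abs2_le_normp (n_le z).
(* From c <= p^2 <= L p. *)
have pxL : c / L <= p x.
  rewrite ler_pdivrMr// (le_trans (p_ge x))// expr2 ler_pM2l//.
  exact: le_trans (ler_norm _) (pL x).
pose E z := tau + a z + kop P s p z.
have Ey : 0 <= E y by rewrite -(pmulr_rge0 _ (n_gt0 y)) -eqp oppr_ge0.
have Ex : E x <= - (p x / Phi).
  rewrite -(ler_pM2l (n_gt0 x)) -eqp mulrN lerN2 mulrA ler_pdivrMr//.
  by rewrite mulrC ler_pM2l.
have : E y - E x <= L * (`|a x - a y| + avg P (fun u => `|s x u - s y u|)).
  have -> : E y - E x = (a y - a x) + (kop P s p y - kop P s p x).
    by rewrite /E; ring.
  rewrite mulrDr lerD//.
    apply: (@le_trans _ _ `|a x - a y|); first by rewrite distrC ler_norm.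
    by rewrite ler_peMl.
  have bd : bmeas (fun u => s x u - s y u) by apply: bmeasB; exact: bmeas_row bs _.
  rewrite /kop -avgB; [|exact: bmeas_kop_ker..].
  rewrite -avgZ; last exact: bmeas_norm.
  apply: le_avg.
  - by apply: bmeasB; exact: bmeas_kop_ker.
  - by apply: bmeasM; [exact: bmeas_cst|exact: bmeas_norm].
  move=> u; rewrite -mulrBl; apply: le_trans (ler_norm _) _.
  by rewrite normrM mulrC distrC; apply: ler_wpM2r.
move=> EE; rewrite -(ler_pM2l L0); apply: le_trans EE.
have -> : L * theta = c / L / Phi.
  by rewrite /theta; field; rewrite !gt_eqF.
have : c / L / Phi <= p x / Phi by rewrite ler_pM2r ?invr_gt0.
lra.
Qed.

(* The symmetry of [S] cancels the quadratic terms. *)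
Lemma dyson_avg_im_le (tau1 tau2 eta1 eta2 : R) p1 h1 p2 h2 :
  dyson P a s tau1 eta1 p1 h1 -> dyson P a s tau2 eta2 p2 h2 ->
  (forall x, p1 x ^+ 2 + h1 x ^+ 2 <= p2 x ^+ 2 + h2 x ^+ 2) ->
  eta2 * avg P h1 <= eta1 * avg P h2.
Proof.
move=> dy1 dy2 n12.
have [_ bh1 h10 _ eqh1] := dy1; have [_ bh2 h20 _ eqh2] := dy2.
have bZ h c : bmeas h -> bmeas (fun x => c * h x).
  by move=> bh; apply: bmeasM => //; exact: bmeas_cst.
have bM f g : bmeas f -> bmeas g -> bmeas (fun x => f x * kop P s g x).
  by move=> bf bg; apply: bmeasM => //; exact: bmeas_kop.
(* By the imaginary parts of the equations the two integrands are h1 h2 / |m2|^2 and h1 h2 /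
   |m1|^2. *)
have : avg P (fun x => eta2 * h1 x + h1 x * kop P s h2 x) <=
       avg P (fun x => eta1 * h2 x + h2 x * kop P s h1 x).
  apply: le_avg; [by apply: bmeasD; [exact: bZ|exact: bM]..|].
  move=> x; have n1 := dyson_abs2_gt0 x dy1; have n2 := dyson_abs2_gt0 x dy2.
  have k1 : eta1 + kop P s h1 x = h1 x / (p1 x ^+ 2 + h1 x ^+ 2).
    by rewrite [X in X / _]eqh1 mulrC mulKf ?gt_eqF.
  have k2 : eta2 + kop P s h2 x = h2 x / (p2 x ^+ 2 + h2 x ^+ 2).
    by rewrite [X in X / _]eqh2 mulrC mulKf ?gt_eqF.
  have -> : eta2 * h1 x + h1 x * kop P s h2 x = h1 x * (eta2 + kop P s h2 x).
    by ring.
  have -> : eta1 * h2 x + h2 x * kop P s h1 x = h2 x * (eta1 + kop P s h1 x).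
    by ring.
  rewrite k1 k2 mulrA mulrA [h2 x * h1 x]mulrC ler_pM2l ?mulr_gt0//.
  by rewrite lef_pV2 ?posrE.
rewrite avgD; [|exact: bZ|exact: bM]; rewrite avgD; [|exact: bZ|exact: bM].
by rewrite (avg_kop_sym P bs s_sym bh1 bh2) lerD2r !avgZ.
Qed.

End dyson_estimates.

(** * Majorants of |m| on a vertical line *)

Section dyson_majorant.
Context {d : measure_display} {X : measurableType d} {R : realType}.
Variable P : probability X R.
Variables (a : X -> R) (s : X -> X -> R) (B : R).
Hypothesis bs : bmeas (fun p : X * X => s p.1 p.2).
Hypothesis s_ge0 : forall x y, 0 <= s x y.
Hypothesis s_sym : forall x y, s x y = s y x.
Hypothesis B_gt0 : 0 < B.
Hypothesis s_le : forall x y, s x y <= B.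

(** |z + a + S m| is at least its imaginary part, which is at least [eta]. *)
Lemma dyson_abs2_im_le (tau eta : R) p h x : 0 < eta ->
  dyson P a s tau eta p h -> p x ^+ 2 + h x ^+ 2 <= eta ^- 2.
Proof.
move=> eta0 dy; have n0 := dyson_abs2_gt0 x dy.
rewrite -[leLHS]invrK lef_pV2 ?posrE ?invr_gt0 ?exprn_gt0//.
rewrite (dyson_inv_abs2 x dy) -[leLHS]add0r; apply: lerD; first exact: sqr_ge0.
have [_ _ h0 _ _] := dy.
have kh : 0 <= kop P s h x by apply: kop_ge0 => // y; exact: ltW.
by rewrite lerXn2r ?nnegrE ?lerDl// ?addr_ge0// ltW.
Qed.

(** If |m| <= w, then |S p| <= S w, so the supersolution property gives |z + a + S m| >= 1/w +
    delta. Hence |m| <= 1 / (1/w + delta) = w - delta w^2 / (1 + delta w). The gain has a positive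
    lower bound independent of [x] and [eta], which allows continuation by steps of fixed length. *)
Lemma dyson_majorant_improve (tau eta sigma w0 W delta : R) p h w :
  sigma ^+ 2 = 1 -> 0 < w0 -> 0 < delta -> bmeas w ->
  (forall x, w0 <= w x <= W) ->
  (forall x, (w x)^-1 + kop P s w x + delta <= - (sigma * (tau + a x))) ->
  dyson P a s tau eta p h -> (forall x, p x ^+ 2 + h x ^+ 2 <= w x ^+ 2) ->
  forall x, p x ^+ 2 + h x ^+ 2 <=
    (w x - delta * w0 ^+ 2 / (1 + delta * W)) ^+ 2 /\
    delta * w0 ^+ 2 / (1 + delta * W) <= w x.
Proof.
move=> sigma1 w0_gt0 delta0 bw wW super dy n_le x.
have w_gt0 y : 0 < w y by have /andP[+ _] := wW y; exact: lt_le_trans.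
have W_gt0 : 0 < W by have /andP[_] := wW x; exact: lt_le_trans.
have n_gt0 := dyson_abs2_gt0 x dy.
have inv_n := dyson_inv_abs2 x dy.
have [bp _ _ _ _] := dy.
have pw y : `|p y| <= w y.
  rewrite -ler_sqr ?nnegrE// ?(ltW (w_gt0 y))// real_normK ?num_real//.
  by apply: le_trans (n_le y); rewrite lerDl sqr_ge0.
have ks : `|kop P s p x| <= kop P s w x by exact: norm_kop_le.
have sig : `|sigma| = 1.
  by apply: (pexpIrn (n := 2)); rewrite ?nnegrE// real_normK ?num_real// expr1n.
have Ege : (w x)^-1 + delta <= - (sigma * (tau + a x + kop P s p x)).
  have : - (sigma * kop P s p x) >= - kop P s w x.
    by rewrite lerN2 (le_trans (ler_norm _))// normrM sig mul1r.
  have := super x; rewrite [sigma * (_ + kop _ _ _ _)]mulrDr; lra.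
have wd : 0 < (w x)^-1 + delta by rewrite addr_gt0// invr_gt0.
have nle : p x ^+ 2 + h x ^+ 2 <= (((w x)^-1 + delta)^-1) ^+ 2.
  rewrite exprVn -[leLHS]invrK lef_pV2 ?posrE ?invr_gt0 ?exprn_gt0//.
  rewrite inv_n; apply: (@le_trans _ _ ((tau + a x + kop P s p x) ^+ 2)).
    have -> : (tau + a x + kop P s p x) ^+ 2 =
        (- (sigma * (tau + a x + kop P s p x))) ^+ 2.
      by rewrite sqrrN exprMn sigma1 mul1r.
    by rewrite lerXn2r ?nnegrE ?(ltW wd)//; apply: le_trans Ege; exact: ltW.
  by rewrite lerDl sqr_ge0.
have d1 : 0 < 1 + delta * W by rewrite addr_gt0// mulr_gt0.
have d2 : 0 < 1 + delta * w x by rewrite addr_gt0// mulr_gt0.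
set e := delta * w0 ^+ 2 / (1 + delta * W).
have ee : e <= delta * w x ^+ 2 / (1 + delta * w x).
  have /andP[w0w wWx] := wW x.
  rewrite /e; apply: ler_pM.
  - by rewrite mulr_ge0 ?sqr_ge0// ltW.
  - by rewrite invr_ge0 ltW.
  - by rewrite ler_pM2l// lerXn2r// nnegrE ltW.
  - by rewrite lef_pV2 ?posrE// lerD2l ler_pM2l.
have wE : ((w x)^-1 + delta)^-1 = w x - delta * w x ^+ 2 / (1 + delta * w x).
  field; rewrite !gt_eqF//=.
have we : ((w x)^-1 + delta)^-1 <= w x - e by rewrite wE lerD2l lerN2.
have wV : 0 < ((w x)^-1 + delta)^-1 by rewrite invr_gt0.
split; last by rewrite -subr_ge0; apply: le_trans we; exact: ltW.
apply: (le_trans nle); rewrite lerXn2r ?nnegrE ?(ltW wV)//.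
by apply: le_trans we; exact: ltW.
Qed.

(* Continuation in [eta] down from large [eta], where [|m| <= 1 / eta]. *)
Lemma dyson_majorant (tau sigma w0 W delta : R) (p h : R -> X -> R) w :
  sigma ^+ 2 = 1 -> 0 < w0 -> 0 < delta -> bmeas w ->
  (forall x, w0 <= w x <= W) ->
  (forall x, (w x)^-1 + kop P s w x + delta <= - (sigma * (tau + a x))) ->
  (forall eta, 0 < eta -> dyson P a s tau eta (p eta) (h eta)) ->
  (forall eta0 eta eta' x, 0 < eta0 -> eta0 <= eta -> eta0 <= eta' ->
     `|p eta' x - p eta x| <= `|eta' - eta| / eta0 ^+ 2 /\
     `|h eta' x - h eta x| <= `|eta' - eta| / eta0 ^+ 2) ->
  forall eta, 0 < eta -> forall x, p eta x ^+ 2 + h eta x ^+ 2 <= w x ^+ 2.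
Proof.
move=> sigma1 w0_gt0 delta0 bw wW super dy lip eta0 eta0_gt0 x0.
have w_gt0 y : 0 < w y by have /andP[+ _] := wW y; exact: lt_le_trans.
have W_gt0 : 0 < W by have /andP[_] := wW x0; exact: lt_le_trans.
pose e := delta * w0 ^+ 2 / (1 + delta * W).
have e0 : 0 < e.
  rewrite divr_gt0//; first by rewrite mulr_gt0// exprn_gt0.
  by rewrite addr_gt0// mulr_gt0.
(* Step length for which the Lipschitz constant [1 / eta0 ^+ 2] moves [p] and [h] by at most
   [e / 2]. *)
pose rho := eta0 ^+ 2 * (e / 2).
have rho0 : 0 < rho by rewrite mulr_gt0 ?exprn_gt0// divr_gt0.
pose H := eta0 + w0^-1.
(* Descends in steps of at most [rho] and stops at [eta0]. The start exceeds [w0^-1], where |m| <= 1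
   / eta <= w0 holds outright. *)
pose etak (k : nat) := eta0 + Num.max 0 (w0^-1 - rho *+ k).
have etak_ge k : eta0 <= etak k by rewrite lerDl le_max lexx.
have etak_gt0 k : 0 < etak k by exact: lt_le_trans (etak_ge k).
have etakS k : `|etak k.+1 - etak k| <= rho.
  rewrite /etak mulrSr; set z := w0^-1 - rho *+ k.
  rewrite (_ : w0^-1 - _ = z - rho); last by rewrite /z; ring.
  rewrite ler_norml /Num.max; case: ifP; case: ifP; move: rho0; lra.
have main k x : p (etak k) x ^+ 2 + h (etak k) x ^+ 2 <= w x ^+ 2.
  elim: k x => [|k IH] x.
    apply: (le_trans (dyson_abs2_im_le x (etak_gt0 0%N) (dy _ (etak_gt0 0%N)))).
    apply: (@le_trans _ _ (w0 ^+ 2)); last first.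
      rewrite lerXn2r ?nnegrE ?(ltW w0_gt0) ?(ltW (w_gt0 x))//.
      by have /andP[] := wW x.
    rewrite -exprVn lerXn2r ?nnegrE ?invr_ge0 ?(ltW (etak_gt0 _)) ?(ltW w0_gt0)//.
    rewrite -[leRHS]invrK lef_pV2 ?posrE ?invr_gt0//.
    rewrite /etak mulr0n subr0 max_r ?invr_ge0 ?(ltW w0_gt0)//.
    by rewrite lerDr ltW.
  have [n_le e_le] := dyson_majorant_improve sigma1 w0_gt0 delta0 bw wW super
    (dy _ (etak_gt0 k)) IH x.
  have [lp lh] := lip _ _ _ x eta0_gt0 (etak_ge k) (etak_ge k.+1).
  have dle : `|etak k.+1 - etak k| / eta0 ^+ 2 <= e / 2.
    by rewrite ler_pdivrMr ?exprn_gt0// mulrC; exact: etakS.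
  move: (le_trans lp dle) (le_trans lh dle) n_le e_le.
  rewrite -/e; set p' := p (etak k.+1) x; set h' := h (etak k.+1) x.
  set p1 := p (etak k) x; set h1 := h (etak k) x => lp' lh' n_le e_le.
  (* One step raises each of p^2 and h^2 by at most (w - e) e + e^2 / 4; twice this is below w^2 -
     (w - e)^2 = 2 (w - e) e + e^2. *)
  have bound (u u1 v : R) : 0 <= w x - e -> u1 ^+ 2 + v ^+ 2 <= (w x - e) ^+ 2 ->
      `|u - u1| <= e / 2 -> u ^+ 2 <= u1 ^+ 2 + (w x - e) * e + (e / 2) ^+ 2.
    move=> we u1_le uu1.
    have u1w : `|u1| <= w x - e.
      rewrite -ler_sqr ?nnegrE// real_normK ?num_real//.
      by apply: le_trans u1_le; rewrite lerDl sqr_ge0.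
    have -> : u ^+ 2 = u1 ^+ 2 + u1 * (u - u1) * 2 + (u - u1) ^+ 2 by ring.
    rewrite -addrA -[leRHS]addrA lerD2l; apply: lerD.
      have : `|u1 * (u - u1)| <= (w x - e) * (e / 2) by rewrite normrM ler_pM.
      have := ler_norm (u1 * (u - u1)); lra.
    rewrite -(real_normK (num_real (u - u1))) lerXn2r ?nnegrE//.
    exact: le_trans uu1.
  have we0 : 0 <= w x - e by rewrite subr_ge0.
  have b1 := bound _ _ _ we0 n_le lp'.
  have n_le' : h1 ^+ 2 + p1 ^+ 2 <= (w x - e) ^+ 2 by rewrite addrC.
  have b2 := bound _ _ _ we0 n_le' lh'.
  apply: (le_trans (lerD b1 b2)).
  have -> : w x ^+ 2 = (w x - e) ^+ 2 + 2 * (w x - e) * e + e ^+ 2 by ring.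
  have : 0 <= e ^+ 2 by exact: sqr_ge0.
  have -> : (e / 2) ^+ 2 = e ^+ 2 / 4 by field.
  lra.
pose k := (Num.bound (w0^-1 / rho)).
have kP : w0^-1 <= rho *+ k.
  rewrite -mulr_natr mulrC -ler_pdivrMr// ltW//.
  have := archi_boundP (x := w0^-1 / rho); apply.
  by rewrite divr_ge0 ?invr_ge0// ltW.
have := main k x0; rewrite /etak max_l ?addr0//.
by rewrite subr_le0.
Qed.

End dyson_majorant.

(** * Stieltjes transforms of continuous densities *)

(** Together with [stieltjes_im], the real and imaginary parts of 1/(t - z) at z = tau + i eta; the
    imaginary part is pi times the Poisson kernel. *)
Definition stieltjes_re {R : realType} (tau eta t : R) : R :=
  (t - tau) / ((t - tau) ^+ 2 + eta ^+ 2).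

Definition stieltjes_im {R : realType} (tau eta t : R) : R :=
  eta / ((t - tau) ^+ 2 + eta ^+ 2).

Section stieltjes_kernel.
Context {R : realType}.
Implicit Types tau eta t : R.

Lemma stieltjes_reE (v : R -> R) tau eta :
  complex.Re (stieltjes v (Complex tau eta)) =
  Rintegral (@lebesgue_measure R) setT (fun t => v t * stieltjes_re tau eta t).
Proof.
congr fine; apply: eq_integral => t _ /=; congr (_%:E).
by rewrite /stieltjes_re sub0r sqrrN.
Qed.

Lemma stieltjes_imE (v : R -> R) tau eta :
  complex.Im (stieltjes v (Complex tau eta)) =
  Rintegral (@lebesgue_measure R) setT (fun t => v t * stieltjes_im tau eta t).
Proof.
congr fine; apply: eq_integral => t _ /=; congr (_%:E).
by rewrite /stieltjes_im sub0r sqrrN mulNr opprK.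
Qed.

Lemma stieltjes_den_ge tau eta t : eta ^+ 2 <= (t - tau) ^+ 2 + eta ^+ 2.
Proof. by rewrite lerDr sqr_ge0. Qed.

Lemma stieltjes_den_gt0 tau eta t : 0 < eta -> 0 < (t - tau) ^+ 2 + eta ^+ 2.
Proof.
move=> eta0; apply: lt_le_trans (stieltjes_den_ge _ _ _).
by rewrite exprn_gt0.
Qed.

Lemma continuous_stieltjes_im tau eta : 0 < eta ->
  continuous (stieltjes_im tau eta).
Proof.
move=> eta0 t; apply: cvgM; first exact: cvg_cst.
apply: cvgV; first by rewrite gt_eqF// stieltjes_den_gt0.
apply: cvgD; last exact: cvg_cst.
by rewrite expr2; apply: cvgM; (apply: cvgB; [exact: cvg_id|exact: cvg_cst]).
Qed.

Lemma continuous_stieltjes_re tau eta : 0 < eta ->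
  continuous (stieltjes_re tau eta).
Proof.
move=> eta0 t; apply: cvgM; first by apply: cvgB; [exact: cvg_id|exact: cvg_cst].
apply: cvgV; first by rewrite gt_eqF// stieltjes_den_gt0.
apply: cvgD; last exact: cvg_cst.
by rewrite expr2; apply: cvgM; (apply: cvgB; [exact: cvg_id|exact: cvg_cst]).
Qed.

Lemma stieltjes_im_ge0 tau eta t : 0 < eta -> 0 <= stieltjes_im tau eta t.
Proof. by move=> eta0; rewrite divr_ge0 ?ltW// stieltjes_den_gt0. Qed.

Lemma bmeas_stieltjes_im tau eta : 0 < eta -> bmeas (stieltjes_im tau eta).
Proof.
move=> eta0; split.
  by apply: continuous_measurable_fun; exact: continuous_stieltjes_im.
exists (eta / eta ^+ 2) => t; rewrite ger0_norm ?stieltjes_im_ge0//.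
rewrite ler_pM2l// lef_pV2 ?posrE ?exprn_gt0// ?stieltjes_den_gt0//.
exact: stieltjes_den_ge.
Qed.

Lemma bmeas_stieltjes_re tau eta : 0 < eta -> bmeas (stieltjes_re tau eta).
Proof.
move=> eta0; split.
  by apply: continuous_measurable_fun; exact: continuous_stieltjes_re.
exists eta^-1 => t; have D0 := stieltjes_den_gt0 tau t eta0.
rewrite normrM normfV (gtr0_norm D0) ler_pdivrMr// ler_pdivlMl//.
rewrite -(real_normK (num_real (t - tau))).
set u := `|_|; have : 0 <= (u - eta) ^+ 2 + u ^+ 2 + eta ^+ 2.
  by rewrite !addr_ge0 ?sqr_ge0.
rewrite sqrrB; lra.
Qed.

(** The derivative of 1/(t - z) in z is at most 1/eta0^2 once Im z >= eta0; the proof factors the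
    difference explicitly. *)
Lemma stieltjes_re_lip tau eta0 eta eta' t : 0 < eta0 -> eta0 <= eta ->
  eta0 <= eta' ->
  `|stieltjes_re tau eta' t - stieltjes_re tau eta t| <=
  `|eta' - eta| / eta0 ^+ 2.
Proof.
move=> e00 le_e le_e'; have e0 := lt_le_trans e00 le_e.
have e0' := lt_le_trans e00 le_e'.
rewrite /stieltjes_re; set u := t - tau.
have D0 := stieltjes_den_gt0 tau t e0; have D0' := stieltjes_den_gt0 tau t e0'.
rewrite -/u in D0 D0'; have := real_normK (num_real u) => uu.
have -> : u / (u ^+ 2 + eta' ^+ 2) - u / (u ^+ 2 + eta ^+ 2) =
   (eta - eta') * ((u * (eta + eta')) / ((u ^+ 2 + eta ^+ 2) * (u ^+ 2 + eta' ^+ 2))).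
  by field; rewrite !gt_eqF.
rewrite normrM distrC; apply: ler_wpM2l => //.
rewrite normrM normfV (gtr0_norm (mulr_gt0 D0 D0')) normrM.
rewrite (gtr0_norm (addr_gt0 e0 e0')) ler_pdivrMr ?mulr_gt0//.
rewrite ler_pdivlMl ?exprn_gt0//.
rewrite -uu; set w := `|u|; have w0 : 0 <= w by exact: normr_ge0.
(* In each product AM-GM bounds one factor by one denominator, while the other denominator is at
   least [eta0 ^+ 2]. *)
have k1 : 2 * (w * eta) <= w ^+ 2 + eta ^+ 2.
  by have := sqr_ge0 (w - eta); rewrite sqrrB; lra.
have k2 : 2 * (w * eta') <= w ^+ 2 + eta' ^+ 2.
  by have := sqr_ge0 (w - eta'); rewrite sqrrB; lra.
have l1 : eta0 ^+ 2 <= w ^+ 2 + eta ^+ 2.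
  by apply: (@le_trans _ _ (eta ^+ 2)); rewrite ?lerDr ?sqr_ge0// lerXn2r// nnegrE ltW.
have l2 : eta0 ^+ 2 <= w ^+ 2 + eta' ^+ 2.
  by apply: (@le_trans _ _ (eta' ^+ 2)); rewrite ?lerDr ?sqr_ge0// lerXn2r// nnegrE ltW.
have s0 : 0 <= eta0 ^+ 2 by exact: sqr_ge0.
have m1 : 2 * (w * eta) * eta0 ^+ 2 <= (w ^+ 2 + eta ^+ 2) * (w ^+ 2 + eta' ^+ 2).
  by apply: ler_pM => //; rewrite mulr_ge0// mulr_ge0// ltW.
have m2 : 2 * (w * eta') * eta0 ^+ 2 <= (w ^+ 2 + eta' ^+ 2) * (w ^+ 2 + eta ^+ 2).
  by apply: ler_pM => //; rewrite mulr_ge0// mulr_ge0// ltW.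
lra.
Qed.

Lemma stieltjes_im_lip tau eta0 eta eta' t : 0 < eta0 -> eta0 <= eta ->
  eta0 <= eta' ->
  `|stieltjes_im tau eta' t - stieltjes_im tau eta t| <=
  `|eta' - eta| / eta0 ^+ 2.
Proof.
move=> e00 le_e le_e'; have e0 := lt_le_trans e00 le_e.
have e0' := lt_le_trans e00 le_e'.
rewrite /stieltjes_im; set u := t - tau.
have D0 := stieltjes_den_gt0 tau t e0; have D0' := stieltjes_den_gt0 tau t e0'.
rewrite -/u in D0 D0'.
have -> : eta' / (u ^+ 2 + eta' ^+ 2) - eta / (u ^+ 2 + eta ^+ 2) =
   (eta' - eta) * ((u ^+ 2 - eta * eta') / ((u ^+ 2 + eta ^+ 2) * (u ^+ 2 + eta' ^+ 2))).
  by field; rewrite !gt_eqF.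
rewrite normrM; apply: ler_wpM2l => //.
rewrite normrM normfV (gtr0_norm (mulr_gt0 D0 D0')).
rewrite ler_pdivrMr ?mulr_gt0// ler_pdivlMl ?exprn_gt0//.
have ee : eta0 ^+ 2 <= eta * eta' by rewrite expr2 ler_pM// ltW.
have e1 : 0 < eta * eta' by exact: mulr_gt0.
have nle : `|u ^+ 2 - eta * eta'| <= u ^+ 2 + eta * eta'.
  apply: le_trans (ler_normB _ _) _.
  by rewrite (gtr0_norm e1) ger0_norm// sqr_ge0.
apply: (@le_trans _ _ (eta * eta' * (u ^+ 2 + eta * eta'))).
  by apply: ler_pM => //; exact: sqr_ge0.
rewrite -subr_ge0.
have -> : (u ^+ 2 + eta ^+ 2) * (u ^+ 2 + eta' ^+ 2) -
  eta * eta' * (u ^+ 2 + eta * eta') = u ^+ 2 * u ^+ 2 +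
    u ^+ 2 * ((eta - eta') ^+ 2 + eta * eta') by ring.
by rewrite addr_ge0// mulr_ge0 ?sqr_ge0// addr_ge0 ?sqr_ge0// ltW.
Qed.

(** An antiderivative is atan((t - tau) / eta), whose total variation is at most pi for every
    [eta]. *)
Lemma integral_stieltjes_im_le tau eta rho : 0 < eta -> 0 < rho ->
  (\int[@lebesgue_measure R]_(t in `[(tau - rho)%R, (tau + rho)%R])
     (stieltjes_im tau eta t)%:E <= pi%:E)%E.
Proof.
move=> eta0 rho0; pose F t := atan ((t - tau) / eta).
have dF t : is_derive t 1 F (stieltjes_im tau eta t).
  have d1 : is_derive t 1 (fun u : R => (u - tau) / eta) (eta^-1).
    apply/is_derive1_caratheodory; exists (fun=> eta^-1); split => //.
      by move=> z; ring.
    exact: cvg_cst.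
  have D0 := stieltjes_den_gt0 tau t eta0.
  have -> : stieltjes_im tau eta t = (1 + ((t - tau) / eta) ^+ 2)^-1 * eta^-1.
    rewrite /stieltjes_im; have := D0.
    have -> : 1 + ((t - tau) / eta) ^+ 2 =
        ((t - tau) ^+ 2 + eta ^+ 2) / eta ^+ 2 by field; rewrite gt_eqF.
    by move=> ?; field; rewrite !gt_eqF.
  exact: is_derive1_comp.
rewrite (@continuous_FTC2 _ _ F).
- rewrite -EFinB lee_fin /F.
  have := atan_ltpi2 ((tau + rho - tau) / eta).
  have := atan_gtNpi2 ((tau - rho - tau) / eta); lra.
- lra.
- by apply: continuous_subspaceT => x; exact: continuous_stieltjes_im.
- have cF t : F x @[x --> t] --> F t.
    by apply: differentiable_continuous; apply/derivable1_diffP; have [] := dF t.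
  split => [t _||]; first by have [] := dF t.
    by apply: cvg_at_right_filter; exact: cF.
  by apply: cvg_at_left_filter; exact: cF.
- by move=> t _; rewrite derive1E; apply: derive_val.
Qed.

End stieltjes_kernel.

(** * The Stieltjes transform near zeros and near positive points of the density *)

Section stieltjes_transform.
Context {R : realType}.
Local Notation leb := (@lebesgue_measure R).
Variable v : R -> R.
Hypothesis v_cont : continuous v.
Hypothesis v_ge0 : forall t, 0 <= v t.
Hypothesis v_mass : (\int[leb]_t (v t)%:E = 1)%E.

Lemma measurable_density : measurable_fun setT v.
Proof. exact: continuous_measurable_fun. Qed.

Lemma integrable_density : leb.-integrable setT (EFin \o v).
Proof.
apply/integrableP; split; first by apply/measurable_EFinP; exact: measurable_density.
under eq_integral do rewrite /= ger0_norm//.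
by rewrite v_mass ltry.
Qed.

Lemma Rintegral_density : Rintegral leb setT v = 1.
Proof. by rewrite /Rintegral v_mass. Qed.

Lemma integrable_densityM k : bmeas k ->
  leb.-integrable setT (EFin \o (fun t => v t * k t)).
Proof.
move=> [mk [C kC]].
apply: (@integrableMl _ _ _ leb setT measurableT (EFin \o v) k) => //.
  exact: integrable_density.
exists C; split; first exact: num_real.
by move=> M CM x _; exact: le_trans (kC x) (ltW CM).
Qed.

(** As [v] has mass one, uniform bounds on kernels pass to their integrals with the same
    constant. *)
Lemma Rintegral_density_dist k1 k2 M : bmeas k1 -> bmeas k2 ->
  (forall t, `|k1 t - k2 t| <= M) ->
  `|Rintegral leb setT (fun t => v t * k1 t) -
    Rintegral leb setT (fun t => v t * k2 t)| <= M.
Proof.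
move=> b1 b2 k12; rewrite -RintegralB//; try exact: integrable_densityM.
have ib : leb.-integrable setT (EFin \o (fun t => v t * (k1 t - k2 t))).
  by apply: integrable_densityM; exact: bmeasB.
have -> : (fun t => v t * k1 t - v t * k2 t) = (fun t => v t * (k1 t - k2 t)).
  by apply/funext => t; ring.
apply: (le_trans (le_normr_Rintegral _ ib)) => //.
apply: (@le_trans _ _ (Rintegral leb setT (fun t => v t * M))).
  apply: le_Rintegral => //.
  - exact: integrable_norm.
  - by apply: integrable_densityM; exact: bmeas_cst.
  by move=> t _; rewrite normrM ger0_norm// ler_wpM2l.
by rewrite RintegralZr// ?Rintegral_density ?mul1r//; exact: integrable_density.
Qed.

(** On [tau, tau + eta], of length eta, the kernel is at least 1 / (2 eta). *)
Lemma stieltjes_im_ge tau rho c eta : 0 < c ->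
  (forall t, tau <= t <= tau + rho -> c <= v t) -> 0 < eta <= rho ->
  c / 2 <= complex.Im (stieltjes v (Complex tau eta)).
Proof.
move=> c0 vc /andP[eta0 eta_rho]; rewrite stieltjes_imE.
pose A : set (measurableTypeR R) := `[tau, tau + eta]%classic.
have mA : measurable A by exact: measurable_itv.
have lA : (leb A = eta%:E)%E.
  by rewrite /A lebesgue_measure_itv/= lte_fin ltrDl eta0 -EFinB addrAC subrr add0r.
apply: (@le_trans _ _ (Rintegral leb A (fun t => c / (2 * eta)))).
  rewrite Rintegral_cst// (_ : fine _ = eta); last exact: (congr1 fine lA).
  by rewrite (_ : c / (2 * eta) * eta = c / 2)//; field; rewrite gt_eqF.
rewrite Rintegral_mkcond; apply: le_Rintegral => //.
- rewrite -restrict_EFin; apply: (iffLR (integrable_mkcond _ mA)).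
  apply: measurable_bounded_integrable => //; first by
    apply: (eq_ind_r (fun l => (l < +oo)%E) _ lA); rewrite ltry.
  exists (`|c / (2 * eta)|); split; first exact: num_real.
  by move=> M CM x _; exact: ltW.
- by apply: integrable_densityM; exact: bmeas_stieltjes_im.
move=> t _; rewrite patchE; case: ifPn => [|_]; last first.
  by rewrite mulr_ge0// stieltjes_im_ge0.
rewrite inE /A/= in_itv/= => /andP[tau_t t_tau].
rewrite /stieltjes_im.
have D0 := stieltjes_den_gt0 tau t eta0.
apply: (@le_trans _ _ (c * (eta / ((t - tau) ^+ 2 + eta ^+ 2)))); last first.
  apply: ler_wpM2r; first by rewrite divr_ge0// ltW.
  by apply: vc; rewrite tau_t/=; apply: le_trans t_tau _; rewrite lerD2l.
rewrite ler_pM2l// (_ : (2 * eta)^-1 = eta / (2 * eta ^+ 2)); last first.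
  by field; rewrite gt_eqF.
rewrite ler_pM2l// lef_pV2 ?posrE ?mulr_gt0 ?exprn_gt0//.
have : (t - tau) ^+ 2 <= eta ^+ 2.
  rewrite lerXn2r ?nnegrE ?subr_ge0 ?(ltW eta0)//.
  by rewrite lerBlDl.
lra.
Qed.

(** Within distance [rho] of [tau] the density is at most [e] and the kernel integrates to at most
    pi ([f1]); farther away the kernel is at most [eta / rho ^+ 2] and the mass is one ([f2]). *)
Lemma stieltjes_im_le tau rho e eta : 0 < e -> 0 < rho -> 0 < eta ->
  (forall t, `|t - tau| <= rho -> v t <= e) ->
  complex.Im (stieltjes v (Complex tau eta)) <= e * pi + eta / rho ^+ 2.
Proof.
move=> e0 rho0 eta0 ve; rewrite stieltjes_imE.
pose A : set (measurableTypeR R) := `[tau - rho, tau + rho]%classic.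
have mA : measurable A by exact: measurable_itv.
have mI : measurable_fun setT (stieltjes_im tau eta).
  by have [] := bmeas_stieltjes_im tau eta0.
have ik := integrable_densityM (bmeas_stieltjes_im tau eta0).
rewrite -lee_fin /Rintegral fineK; last exact: integrable_fin_num.
pose f1 t := (e * (stieltjes_im tau eta \_ A) t)%:E.
pose f2 t := ((eta / rho ^+ 2) * v t)%:E.
have mR : measurable_fun setT (stieltjes_im tau eta \_ A).
  by apply/(measurable_restrictT _ mA); exact: measurable_funTS.
have R0 t : 0 <= (stieltjes_im tau eta \_ A) t.
  by rewrite patchE; case: ifP => // _; exact: stieltjes_im_ge0.
have c0 : 0 <= eta / rho ^+ 2 by rewrite divr_ge0 ?sqr_ge0// ltW.
apply: (@le_trans _ _ (\int[leb]_t (f1 t + f2 t)%E)%E).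
  apply: ge0_le_integral => //.
  - by move=> t _; rewrite lee_fin mulr_ge0// stieltjes_im_ge0.
  - by apply/measurable_EFinP; apply: measurable_funM => //; exact: measurable_density.
  - apply: emeasurable_funD; apply/measurable_EFinP; apply: measurable_funM => //.
    exact: measurable_density.
  move=> t _; rewrite -EFinD lee_fin patchE; case: ifPn => [|].
    rewrite inE /A/= in_itv/= => /andP[t1 t2].
    apply: ler_wpDr; first by rewrite mulr_ge0.
    apply: ler_wpM2r; first exact: stieltjes_im_ge0.
    by apply: ve; rewrite ler_norml; apply/andP; split; lra.
  rewrite notin_setE /A/= in_itv/= => /negP tA.
  rewrite mulr0 add0r mulrC; apply: ler_wpM2r => //.
  have rho_t : rho <= `|t - tau|.
    rewrite leNgt; apply/negP => /ltW; rewrite ler_norml => /andP[t1 t2].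
    by move/negP: tA; apply; apply/andP; split; lra.
  rewrite ler_pM2l// lef_pV2 ?posrE ?exprn_gt0// ?stieltjes_den_gt0//.
  apply: (@le_trans _ _ ((t - tau) ^+ 2)); last by rewrite lerDl sqr_ge0.
  by rewrite -(real_normK (num_real (t - tau))) lerXn2r ?nnegrE// ltW.
rewrite ge0_integralD//; last 4 first.
- by move=> t _; rewrite lee_fin mulr_ge0// ltW.
- by apply/measurable_EFinP; exact: measurable_funM.
- by move=> t _; rewrite lee_fin mulr_ge0.
- by apply/measurable_EFinP; apply: measurable_funM => //; exact: measurable_density.
rewrite EFinD leeD//.
  rewrite /f1; under eq_integral do rewrite EFinM.
  rewrite ge0_integralZl//; last 3 first.
  - exact/measurable_EFinP.
  - by move=> t _; rewrite lee_fin.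
  - by rewrite lee_fin ltW.
  rewrite EFinM lee_pmul2l// ?lte_fin//.
  have -> : (fun t => ((stieltjes_im tau eta \_ A) t)%:E) =
      (EFin \o stieltjes_im tau eta) \_ A by rewrite restrict_EFin.
  rewrite -integral_mkcond; exact: integral_stieltjes_im_le.
rewrite /f2; under eq_integral do rewrite EFinM.
rewrite ge0_integralZl//; last 2 first.
- by apply/measurable_EFinP; exact: measurable_density.
- by move=> t _; rewrite lee_fin.
by rewrite v_mass mule1.
Qed.

Lemma stieltjes_im_eventually_ge tau : 0 < v tau ->
  exists2 c : R, 0 < c & exists2 rho : R, 0 < rho & forall eta, 0 < eta <= rho ->
    c <= complex.Im (stieltjes v (Complex tau eta)).
Proof.
move=> v0; exists (v tau / 2 / 2); first by rewrite !divr_gt0.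
have /cvgrPdist_lt vc : v @ tau --> v tau by exact: v_cont.
have v20 : 0 < v tau / 2 by exact: divr_gt0.
have /nbhs_ballP[rho /= rho0 H] := vc _ v20.
exists (rho / 2); first exact: divr_gt0.
move=> eta etaP; apply: (stieltjes_im_ge _ _ etaP); first exact: divr_gt0.
move=> t /andP[t1 t2]; have : `|v tau - v t| < v tau / 2.
  apply: H; rewrite /ball/= distrC ger0_norm ?subr_ge0//; lra.
by rewrite ltr_norml => /andP[_]; lra.
Qed.

Lemma stieltjes_im_eventually_le tau e : v tau = 0 -> 0 < e ->
  exists2 rho : R, 0 < rho & forall eta, 0 < eta <= rho ->
    complex.Im (stieltjes v (Complex tau eta)) <= e.
Proof.
move=> v0 e0; pose e1 := e / 2 / pi.
have pi0 := @pi_gt0 R.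
have e10 : 0 < e1 by rewrite !divr_gt0.
have /cvgrPdist_lt vc : v @ tau --> v tau by exact: v_cont.
have /nbhs_ballP[rho /= rho0 H] := vc _ e10.
pose r := rho / 2; have r0 : 0 < r by exact: divr_gt0.
(* The near part contributes [e1 * pi = e / 2]; this threshold on [eta] bounds the far part by the
   other [e / 2]. *)
exists (e / 2 * r ^+ 2); first by rewrite mulr_gt0 ?exprn_gt0// divr_gt0.
move=> eta /andP[eta0 eta_le].
apply: (le_trans (stieltjes_im_le e10 r0 eta0 _)).
  move=> t tr; have : `|v tau - v t| < e1.
    by apply: H; rewrite /ball/= distrC; apply: le_lt_trans tr _; rewrite /r; lra.
  by rewrite v0 sub0r normrN ger0_norm// => /ltW.
rewrite /e1 divfK ?gt_eqF// [leRHS](_ : _ = e / 2 + e / 2); last by field.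
by rewrite lerD2l ler_pdivrMr ?exprn_gt0.
Qed.

End stieltjes_transform.

(** * Zeros of the density *)

Section zero_of_density.
Context {d : measure_display} {X : measurableType d} {R : realType}.
Variable P : probability X R.
Variables (a : X -> R) (s : X -> X -> R) (B : R).
Hypothesis ba : bmeas a.
Hypothesis bs : bmeas (fun p : X * X => s p.1 p.2).
Hypothesis s_ge0 : forall x y, 0 <= s x y.
Hypothesis s_sym : forall x y, s x y = s y x.
Hypothesis B_gt0 : 0 < B.
Hypothesis s_le : forall x y, s x y <= B.
Variables p h : R -> R -> X -> R.
Hypothesis dy : forall tau eta, 0 < eta ->
  dyson P a s tau eta (p tau eta) (h tau eta).
Hypothesis lip : forall tau eta0 eta eta' x, 0 < eta0 -> eta0 <= eta ->
  eta0 <= eta' ->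
  `|p tau eta' x - p tau eta x| <= `|eta' - eta| / eta0 ^+ 2 /\
  `|h tau eta' x - h tau eta x| <= `|eta' - eta| / eta0 ^+ 2.
Variable Phi : R.
Hypothesis Phi_gt0 : 0 < Phi.
Hypothesis n_le : forall tau eta x, 0 < eta ->
  p tau eta x ^+ 2 + h tau eta x ^+ 2 <= Phi.

(** The function w = sigma Re m(t + i eta2) solves 1/w + S w = -sigma (t + a) up to the error h^2 /
    (w |m|^2) <= g/2. Replacing t by tau gains at least g, so w is a supersolution with margin g/2
    and majorizes |m| on the line over tau. The comparison of imaginary parts then makes <Im m(tau +
    i eta)> linear in eta, and the pointwise bound follows. *)
Lemma dyson_im_linear (sigma t tau eta2 g w0 c eps : R) : sigma ^+ 2 = 1 ->
  0 < g -> g <= sigma * (t - tau) -> 0 < eta2 -> 0 < w0 -> 0 < c ->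
  (forall x, w0 <= sigma * p t eta2 x) ->
  (forall x, c <= p t eta2 x ^+ 2 + h t eta2 x ^+ 2) ->
  (forall x, h t eta2 x <= eps) -> eps ^+ 2 <= g / 2 * (w0 * c) ->
  exists C, forall eta x, 0 < eta -> h tau eta x <= C * eta.
Proof.
move=> sigma1 g0 g_le eta20 w00 c0 w_ge n_ge h_le eps_le.
have dy2 := dy t eta20; have [bp bh h0 eqp _] := dy2.
pose w x := sigma * p t eta2 x.
have w_gt0 x : 0 < w x by exact: lt_le_trans (w_ge x).
have w2 x : w x ^+ 2 = p t eta2 x ^+ 2 by rewrite exprMn sigma1 mul1r.
have bw : bmeas w by apply: bmeasM => //; exact: bmeas_cst.
have wW x : w0 <= w x <= 1 + Phi.
  rewrite w_ge/= -(gtr0_norm (w_gt0 x)).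
  by apply: (@abs2_le_normp _ _ (h t eta2 x)) => //; rewrite w2; exact: n_le.
have super x : (w x)^-1 + kop P s w x + g / 2 <= - (sigma * (tau + a x)).
  have n0 := dyson_abs2_gt0 x dy2.
  have -> : kop P s w x = sigma * kop P s (p t eta2) x by exact: kopZ.
  have e1 : - (sigma * (t + a x)) = w x / (p t eta2 x ^+ 2 + h t eta2 x ^+ 2) +
      sigma * kop P s (p t eta2) x.
    have /eqP := eqp x; rewrite -subr_eq0 => /eqP E0.
    apply/eqP; rewrite -subr_eq0; apply/eqP.
    rewrite (_ : _ - _ = sigma / (p t eta2 x ^+ 2 + h t eta2 x ^+ 2) *
      (- p t eta2 x - (p t eta2 x ^+ 2 + h t eta2 x ^+ 2) *
        (t + a x + kop P s (p t eta2) x))); first by rewrite E0 mulr0.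
    by rewrite /w; field; rewrite gt_eqF.
  have e2 : (w x)^-1 - w x / (p t eta2 x ^+ 2 + h t eta2 x ^+ 2) <= g / 2.
    rewrite (_ : _ - _ =
      h t eta2 x ^+ 2 / (w x * (p t eta2 x ^+ 2 + h t eta2 x ^+ 2))); last first.
      have h2 : h t eta2 x ^+ 2 = p t eta2 x ^+ 2 + h t eta2 x ^+ 2 - w x ^+ 2.
        by rewrite w2; ring.
      by rewrite [X in _ = X / _]h2; field; rewrite !gt_eqF.
    rewrite ler_pdivrMr; last exact: mulr_gt0 (w_gt0 x) n0.
    apply: (@le_trans _ _ (eps ^+ 2)).
      rewrite lerXn2r ?nnegrE//; first exact: (ltW (h0 x)).
      exact: le_trans (ltW (h0 x)) (h_le x).
    apply: (le_trans eps_le); rewrite ler_pM2l ?divr_gt0//.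
    by apply: ler_pM; [exact: ltW|exact: ltW|exact: w_ge|exact: n_ge].
  move: e1 e2 g_le; lra.
have lip_tau eta0 eta eta' x := @lip tau eta0 eta eta' x.
have maj := dyson_majorant bs s_ge0 sigma1 w00 (divr_gt0 g0 (ltr0Sn R 1)) bw wW super
  (dy tau) lip_tau.
pose G := avg P (h t eta2).
exists (Phi * (1 + B * (G / eta2))) => eta x eta0.
have dy1 := dy tau eta0.
apply: (le_trans (dyson_im_le_avg bs s_ge0 s_le x eta0 dy1 _)).
  by move=> y; exact: n_le.
have avg_le : avg P (h tau eta) <= eta * G / eta2.
  rewrite ler_pdivlMr// mulrC.
  apply: (dyson_avg_im_le bs s_sym dy1 dy2) => y.
  by apply: le_trans (maj _ eta0 y) _; rewrite w2 lerDl sqr_ge0.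
rewrite -mulrA ler_pM2l// mulrDl mul1r lerD2l -mulrA ler_pM2l//.
by apply: le_trans avg_le _; rewrite -!mulrA [eta * _]mulrC mulrA.
Qed.

(** The sign of Re m(t + i eta2) decides the side: the positive sign handles [t1], the negative one
    [t2]. *)
Lemma dyson_zero_one_sided (delta : R) (K : nat) (x0 : X) (t1 t t2 : R) :
  0 < delta -> (forall x y, delta <= skern P s K x y) ->
  ereal_sup [set ereal_inf
      [set (`|a x - a y| + avg P (fun u => `|s x u - s y u|))%:E
         | x in A & y in ~` A]
    | A in [set A : set X | [/\ measurable A, A !=set0 & A != setT]]] = 0%E ->
  t1 < t < t2 ->
  (forall e, 0 < e -> exists2 rho, 0 < rho &
     forall eta, 0 < eta <= rho -> h t eta x0 <= e) ->
  (exists C, forall eta x, 0 < eta -> h t1 eta x <= C * eta) \/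
  (exists C, forall eta x, 0 < eta -> h t2 eta x <= C * eta).
Proof.
move=> delta0 sK hypD /andP[t1t tt2] h_small.
have [c c0 n_ge] := dyson_abs2_ge P ba bs s_ge0 B_gt0 s_le t Phi_gt0.
pose g := Num.min (t - t1) (t2 - t).
have g0 : 0 < g by rewrite lt_min !subr_gt0 t1t.
pose w0 := Num.sqrt (c / 2).
have c20 : 0 < c / 2 by exact: divr_gt0.
have w00 : 0 < w0 by rewrite sqrtr_gt0.
have w02 : w0 ^+ 2 = c / 2 by rewrite sqr_sqrtr// ltW.
(* The first entry keeps (Re m)^2 >= c/2; the second is the error allowed in [dyson_im_linear]. *)
pose eps2 := Num.min (c / 2) (g / 2 * (w0 * c)).
have eps20 : 0 < eps2 by rewrite lt_min c20/= mulr_gt0 ?mulr_gt0// divr_gt0.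
pose eps := Num.sqrt eps2.
have eps0 : 0 < eps by rewrite sqrtr_gt0.
have epsE : eps ^+ 2 = eps2 by rewrite sqr_sqrtr// ltW.
have [e e0 unif] := dyson_im_uniform a bs s_ge0 B_gt0 s_le t Phi_gt0 c0 delta0 eps0 sK.
have [rho rho0 small] := h_small _ (divr_gt0 e0 (ltr0Sn R 1)).
(* The entries serve the lower bound on |m|, the Harnack inequality, and the smallness of Im m at
   [x0], in this order. *)
pose eta2 := Num.min 1 (Num.min (e / 2) rho).
have eta20 : 0 < eta2 by rewrite !lt_min ltr01 rho0 divr_gt0.
have eta2_1 : eta2 <= 1 by rewrite ge_min lexx.
have eta2_e : eta2 <= e / 2 by rewrite !ge_min lexx orbT.
have eta2_rho : eta2 <= rho by rewrite !ge_min lexx !orbT.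
have e2e : e / 2 < e by rewrite ltr_pdivrMr// ltr_pMr// ltr1n.
have dy2 := dy t eta20.
have nle x := @n_le t eta2 x eta20.
have nge x : c <= p t eta2 x ^+ 2 + h t eta2 x ^+ 2.
  by apply: (n_ge _ _ _ _ dy2 nle); rewrite eta20.
have hle x : h t eta2 x <= eps.
  apply: (unif _ _ _ x0 _ dy2 nle nge).
    by rewrite eta20/=; exact: le_lt_trans e2e.
  by apply: le_lt_trans e2e; apply: small; rewrite eta20.
have h0 x : 0 < h t eta2 x by case: dy2.
have p2 x : c / 2 <= p t eta2 x ^+ 2.
  have : h t eta2 x ^+ 2 <= c / 2.
    apply: (@le_trans _ _ (eps ^+ 2)); last by rewrite epsE ge_min lexx.
    by rewrite lerXn2r ?nnegrE// ltW// h0.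
  have := nge x; lra.
have eps_le : eps ^+ 2 <= g / 2 * (w0 * c) by rewrite epsE ge_min lexx orbT.
have w_ge u : 0 < u -> c / 2 <= u ^+ 2 -> w0 <= u.
  by move=> u0 cu; rewrite -ler_sqr ?nnegrE ?(ltW w00) ?(ltW u0)// w02.
have [p_pos|p_neg] := dyson_re_sign bs Phi_gt0 c20 hypD dy2 nle p2.
- left; apply: (@dyson_im_linear 1 t t1 eta2 g w0 c eps) => //.
  + exact: expr1n.
  + by rewrite mul1r ge_min lexx.
  + by move=> x; rewrite mul1r; exact: w_ge.
- right; apply: (@dyson_im_linear (-1) t t2 eta2 g w0 c eps) => //.
  + by rewrite sqrrN expr1n.
  + by rewrite mulN1r opprB ge_min lexx orbT.
  + move=> x; rewrite mulN1r; apply: w_ge; first by rewrite oppr_gt0.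
    by rewrite sqrrN.
Qed.

End zero_of_density.

(** At w = 0 the expansion forces [v tau0] to vanish, while for small nonzero w on either side the
    cube-root term dominates and makes [v] positive. *)
Lemma no_cusp_in_interval {R : realType} (v : R -> R) (tau0 c C w0 : R) :
  is_interval [set t | 0 < v t] -> 0 < c -> 0 < w0 ->
  ~ (forall w : R, `|w| < w0 ->
      `|v (tau0 + w) - c * (`|w| `^ (3^-1))| <= C * (`|w| `^ (2 / 3))).
Proof.
move=> itv c0 w00 H.
(* [u] is the cube root of |w|: the first two entries give u^3 < w0, the third C u^2 < c u. *)
pose u := Num.min 1 (Num.min (w0 / 2) (c / (2 * (`|C| + 1)))).
have C1 : 0 < `|C| + 1 by rewrite ltr_wpDl.
have u0 : 0 < u by rewrite !lt_min ltr01 !divr_gt0// mulr_gt0.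
have u1 : u <= 1 by rewrite ge_min lexx.
have uw : u <= w0 / 2 by rewrite !ge_min lexx orbT.
have ud : u <= c / (2 * (`|C| + 1)) by rewrite !ge_min lexx !orbT.
have u3 : u ^+ 3 < w0.
  apply: (@le_lt_trans _ _ u); last by apply: (le_lt_trans uw); lra.
  by rewrite exprS ler_piMr ?exprn_ile1// ltW.
have v0 : v tau0 <= 0.
  (* [powR0] needs nonzero exponents, since 0 to the power 0 is 1. *)
  have := H 0; rewrite normr0 addr0 !powR0; last 2 first.
  - by rewrite gt_eqF// divr_gt0.
  - by rewrite gt_eqF// invr_gt0.
  by move=> /(_ w00); rewrite !mulr0 subr0 normr_le0 => /eqP ->.
have root : (u ^+ 3) `^ (3^-1) = u.
  by rewrite -powR_mulrn ?ltW// -powRrM divff// powRr1// ltW.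
have root2 : (u ^+ 3) `^ (2 / 3) = u ^+ 2.
  rewrite -[u ^+ 3]powR_mulrn ?ltW// -powRrM mulrCA divff// mulr1.
  by rewrite powR_mulrn// ltW.
have vpos w : `|w| = u ^+ 3 -> 0 < v (tau0 + w).
  move=> wu; have := H w; rewrite wu => /(_ u3); rewrite root root2.
  rewrite ler_norml => /andP[+ _].
  have : C * u ^+ 2 < c * u.
    rewrite expr2 mulrA ltr_pM2r//; move: ud; rewrite ler_pdivlMr ?mulr_gt0// => ud.
    have : C * u <= (`|C| + 1) * u.
      by rewrite ler_pM2r// (le_trans (ler_norm C))// lerDl.
    lra.
  lra.
have uu : 0 < u ^+ 3 by rewrite exprn_gt0.
have : 0 < v tau0.
  apply: (itv (tau0 + - u ^+ 3) (tau0 + u ^+ 3)).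
  - by apply: vpos; rewrite normrN gtr0_norm.
  - by apply: vpos; rewrite gtr0_norm.
  - by apply/andP; split; lra.
by rewrite ltNge v0.
Qed.

(** * The theorem: from the complex equation to the interval and the absence of cusps *)

Unset Implicit Arguments.
Set Strict Implicit.

Theorem mainTheorem3 (d : measure_display) (X : measurableType d) (R : realType)
  (P : probability X R) (a : X -> R) (s : X -> X -> R)
  (m : R[i] -> X -> R[i]) (v : X -> R -> R)
  (* a in B(X,R) *)
  (a_meas : measurable_fun setT a) (a_bd : bounded_fun a)
  (* s in B(X^2,[0,oo)), symmetric *)
  (s_meas : measurable_fun setT (fun p : X * X => s p.1 p.2))
  (s_bd : bounded_fun (fun p : X * X => s p.1 p.2))
  (s_ge0 : forall x y, 0 <= s x y) (s_sym : forall x y, s x y = s y x)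
  (* m solves the Dyson equation -1/m(z) = z + a + S m(z), with m(z) in B(X,H) *)
  (m_meas : forall z, 0 < complex.Im z ->
     measurable_fun setT (fun x => complex.Re (m z x)) /\
     measurable_fun setT (fun x => complex.Im (m z x)))
  (m_bd : forall z, 0 < complex.Im z ->
     bounded_fun (fun x => complex.Re (m z x)) /\
     bounded_fun (fun x => complex.Im (m z x)))
  (m_H : forall z x, 0 < complex.Im z -> 0 < complex.Im (m z x))
  (m_eq : forall z x, 0 < complex.Im z ->
     (- (m z x)^-1 = z + (a x)%:C + Sop P s (m z) x)%C)
  (* v_x is the continuous Lebesgue density of the probability measure v_x(dtau)
     representing m_x as a Stieltjes transform *)
  (v_cont : forall x, continuous (v x))
  (v_ge0 : forall x t, 0 <= v x t)
  (v_mass : forall x, (\int[@lebesgue_measure R]_t (v x t)%:E = 1)%E)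
  (v_stieltjes : forall z x, 0 < complex.Im z -> m z x = stieltjes (v x) z)
  (* Assumption (A) *)
  (hypA : exists r : X -> X -> R,
     [/\ measurable_fun setT (fun p : X * X => r p.1 p.2),
         bounded_fun (fun p : X * X => r p.1 p.2),
         (forall x y, 0 <= r x y /\ r x y = r y x),
         (forall x y, avg P (fun u => r x u * r u y) <= s x y) &
         (exists2 delta : R, 0 < delta & forall x, delta <= avg P (r x))])
  (* Assumption (B): inf_{x,y} s^(K) x y > 0 for some K >= 1 *)
  (hypB : exists K : nat, exists2 delta : R, 0 < delta &
     forall x y, delta <= skern P s K x y)
  (* Assumption (C) *)
  (hypC : forall M : R, exists2 eps0 : R, 0 < eps0 &
     forall eps : R, 0 < eps < eps0 ->
     forall x, (M%:E <= \int[P]_y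
        ((eps + (a x - a y) ^+ 2 + avg P (fun u => (s x u - s y u) ^+ 2))^-1)%:E)%E)
  (* extra assumption: sup over measurable nonempty proper A of
     inf_{x in A, y notin A} (|a_x - a_y| + <|S_x - S_y|>) equals 0 *)
  (hypD : ereal_sup [set ereal_inf
            [set (`|a x - a y| + avg P (fun u => `|s x u - s y u|))%:E
               | x in A & y in ~` A]
          | A in [set A : set X | [/\ measurable A, A !=set0 & A != setT]]] = 0%E) :
  forall x0 : X,
    (exists i : interval R, [set t | 0 < v x0 t] = [set` i]) /\
    (forall tau0, boundary [set t | 0 < v x0 t] tau0 ->
       ~ exists c : X -> R,
         [/\ measurable_fun setT c, bounded_fun c,
             (exists2 delta : R, 0 < delta & forall x, delta <= c x) &
             (exists C : R, exists2 w0 : R, 0 < w0 &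
               forall x (w : R), `|w| < w0 ->
                 `|v x (tau0 + w) - c x * (`|w| `^ (3^-1))| <= C * (`|w| `^ (2 / 3)))]).
Proof.
move=> x0.
have ba : bmeas a by split => //; exact: bounded_fun_exists.
have bs : bmeas (fun p : X * X => s p.1 p.2).
  by split => //; exact: bounded_fun_exists.
have [B B_gt0 s_le] : exists2 B, 0 < B & forall x y, s x y <= B.
  have [B B0 sB] := bmeas_ge0_bound bs; exists (B + 1); first by rewrite ltr_wpDl.
  move=> x y; apply: le_trans (ler_norm _) _.
  by apply: (le_trans (sB (x, y))); rewrite lerDl.
pose p tau eta x := complex.Re (m (Complex tau eta) x).
pose h tau eta x := complex.Im (m (Complex tau eta) x).
have dy tau eta : 0 < eta -> dyson P a s tau eta (p tau eta) (h tau eta).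
  move=> eta0; have z0 : 0 < complex.Im (Complex tau eta) by [].
  have [mp mh] := m_meas _ z0; have [bp bh] := m_bd _ z0.
  have n_gt0 x : 0 < p tau eta x ^+ 2 + h tau eta x ^+ 2.
    apply: ltr_wpDl; first exact: sqr_ge0.
    by rewrite exprn_gt0// /h; exact: m_H.
  (* Real and imaginary parts of -1/m = -conj(m) / |m|^2. *)
  have eqm x : - (p tau eta x / (p tau eta x ^+ 2 + h tau eta x ^+ 2)) =
        tau + a x + kop P s (p tau eta) x /\
      h tau eta x / (p tau eta x ^+ 2 + h tau eta x ^+ 2) =
        eta + kop P s (h tau eta) x.
    have /eqP := m_eq _ x z0; rewrite eq_complex => /andP[].
    have -> : ((m (Complex tau eta) x)^-1 = Complex
        (p tau eta x / (p tau eta x ^+ 2 + h tau eta x ^+ 2))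
        (- (h tau eta x / (p tau eta x ^+ 2 + h tau eta x ^+ 2))))%C.
      by rewrite /p /h; case: (m _ x).
    have kopE : Sop P s (m (Complex tau eta)) x =
        Complex (kop P s (p tau eta) x) (kop P s (h tau eta) x).
      rewrite /Sop /cavg /kop; congr (Complex (avg P _) (avg P _)).
        by apply/funext => y; rewrite /p; case: (m _ y) => u1 u2 /=; ring.
      by apply/funext => y; rewrite /h; case: (m _ y) => u1 u2 /=; ring.
    by rewrite kopE /= addr0 opprK => /eqP -> /eqP ->.
  split.
  - by split => //; exact: bounded_fun_exists.
  - by split => //; exact: bounded_fun_exists.
  - by move=> x; exact: m_H.
  - by move=> x; have [<- _] := eqm x; rewrite mulrN mulrCA divff ?mulr1// gt_eqF.
  - by move=> x; have [_ <-] := eqm x; rewrite mulrCA divff ?mulr1// gt_eqF.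
have lip tau eta0 eta eta' x : 0 < eta0 -> eta0 <= eta -> eta0 <= eta' ->
    `|p tau eta' x - p tau eta x| <= `|eta' - eta| / eta0 ^+ 2 /\
    `|h tau eta' x - h tau eta x| <= `|eta' - eta| / eta0 ^+ 2.
  move=> e0 e1 e2; have eta_gt0 := lt_le_trans e0 e1.
  have eta'_gt0 := lt_le_trans e0 e2.
  rewrite /p /h !v_stieltjes// !stieltjes_reE !stieltjes_imE.
  split; apply: Rintegral_density_dist => //;
    do ?[exact: bmeas_stieltjes_re|exact: bmeas_stieltjes_im].
  - by move=> t; exact: stieltjes_re_lip.
  - by move=> t; exact: stieltjes_im_lip.
(* (A) bounds the average of |m|^2, then (C) bounds |m|^2 pointwise, uniformly in z. *)
have [Phi Phi_gt0 n_le] : exists2 Phi : R, 0 < Phi & forall tau eta x, 0 < eta ->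
    p tau eta x ^+ 2 + h tau eta x ^+ 2 <= Phi.
  have [r [r_meas r_bd r_sym rs [delta delta0 r_ge]]] := hypA.
  have br : bmeas (fun q : X * X => r q.1 q.2).
    by split => //; exact: bounded_fun_exists.
  have N0 : 0 < (delta ^+ 2)^-1 by rewrite invr_gt0 exprn_gt0.
  have [Phi Phi0 n_le] := dyson_abs2_le bs ba N0 hypC.
  exists Phi => // tau eta x eta0; apply: (n_le _ _ _ _ (dy tau eta eta0)).
  apply: (dyson_avg_abs2_le bs s_ge0 s_sym br _ _ rs delta0 r_ge eta0 (dy tau eta eta0)).
    by move=> y z; have [] := r_sym y z.
  by move=> y z; have [] := r_sym y z.
have itv : is_interval [set t | 0 < v x0 t].
  move=> t1 t2 /= v1 v2 t /andP[t1t tt2].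
  rewrite lt_neqAle v_ge0 andbT; apply/eqP => vt0.
  have t1t' : t1 < t.
    by rewrite lt_neqAle t1t andbT; apply/eqP => tE; rewrite tE -vt0 ltxx in v1.
  have tt2' : t < t2.
    by rewrite lt_neqAle tt2 andbT; apply/eqP => tE; rewrite -tE -vt0 ltxx in v2.
  have hE tau eta : 0 < eta ->
      h tau eta x0 = complex.Im (stieltjes (v x0) (Complex tau eta)).
    by move=> eta0; rewrite /h v_stieltjes.
  (* Where the density is positive, Im m stays bounded below as eta tends to 0, so it cannot be
     O(eta). *)
  have no_linear tau : 0 < v x0 tau ->
      ~ exists C, forall eta x, 0 < eta -> h tau eta x <= C * eta.
    move=> vtau [C hC].
    have [c c0 [rho rho0 Hc]] :=
      stieltjes_im_eventually_ge (v_cont x0) (v_ge0 x0) (v_mass x0) vtau.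
    have C1 : 0 < `|C| + 1 by rewrite ltr_wpDl.
    (* Small enough that [C * eta <= c / 2]. *)
    pose eta := Num.min rho (c / (2 * (`|C| + 1))).
    have eta0 : 0 < eta by rewrite lt_min rho0 divr_gt0// mulr_gt0.
    have : c <= C * eta.
      apply: le_trans (hC _ x0 eta0); rewrite hE//; apply: Hc.
      by rewrite eta0 ge_min lexx.
    have : eta <= c / (2 * (`|C| + 1)) by rewrite ge_min lexx orbT.
    rewrite ler_pdivlMr ?mulr_gt0//.
    have : C * eta <= (`|C| + 1) * eta.
      by rewrite ler_pM2r// (le_trans (ler_norm C))// lerDl.
    lra.
  have [K [delta delta0 sK]] := hypB.
  have := @dyson_zero_one_sided _ _ _ P a s B ba bs s_ge0 s_sym B_gt0 s_le p h dy
    lip Phi Phi_gt0 n_le delta K x0 t1 t t2 delta0 sK hypD.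
  case; [by rewrite t1t'| |exact: no_linear|exact: no_linear].
  move=> e e0; have [rho rho0 Hrho] :=
    stieltjes_im_eventually_le (v_cont x0) (v_ge0 x0) (v_mass x0) (esym vt0) e0.
  by exists rho => // eta etaP; rewrite hE; [exact: Hrho|case/andP: etaP].
split; first by exists (Rhull [set t | 0 < v x0 t]); exact/is_intervalP.
move=> tau0 _ [c [_ _ [delta delta0 c_ge] [C [w0 w00 H]]]].
exact: (no_cusp_in_interval itv (lt_le_trans delta0 (c_ge x0)) w00 (H x0)).
Qed.
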